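(* Let $u$ be the mild solution $u(t,x)=\int_0^t\int_D G(t-s;x,y)\,dW(s,y)$ and let $\widehat u$ be the solution $\widehat u(t,x)=\int_0^t\int_D G(t-s;x,y)\,\widehat W(s,y)\,ds\,dy$ of the regularized problem, $(t,x)\in[0,T]\times\overline D$. Then there exists a real constant $C>0$, independent of $T$, $\Delta t$ and $\Delta x$, such that $$\max_{t\in[0,T]}\left\{\mathbb E\left[\|u(t,\cdot)-\widehat u(t,\cdot)\|_{0,D}^2\right]\right\}^{1/2}\le C\left[\,\big(p_d(\Delta t^{1/4})\big)^{1/2}\,\Delta t^{\frac{4-d}{8}}+\epsilon^{-1/2}\,\Delta x^{\frac{4-d}{2}-\epsilon}\,\right]\qquad\text{for all }\epsilon\in\left(0,\tfrac{4-d}{2}\right].$$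
   Context: $d\in\{2,3\}$, $T>0$, $D=(0,1)^d\subset\mathbb R^d$, $(\Omega,\mathcal F,P)$ is a complete probability space with expectation $\mathbb E$, $\|\cdot\|_{0,D}$ is the norm of $L^2(D)$, $\mathbb N=\{1,2,\dots\}$. For $\alpha\in\mathbb N^d$: $|\alpha|=(\sum_{i=1}^d\alpha_i^2)^{1/2}$, $\lambda_\alpha=\pi^2|\alpha|^2$, $\varepsilon_\alpha(z)=2^{d/2}\prod_{i=1}^d\sin(\alpha_i\pi z_i)$. The kernel is $G(t;x,y)=\sum_{\alpha\in\mathbb N^d}e^{-\lambda_\alpha^2t}\varepsilon_\alpha(x)\varepsilon_\alpha(y)$ for $t\in(0,T]$ (the Green kernel of $\partial_tw+\Delta^2w=0$ in $D$ with $w=\Delta w=0$ on $\partial D$). $\dot W$ is a space-time white noise on $[0,T]\times D$, and $\int\cdots\,dW$ is the (Walsh) stochastic integral with respect to it; for deterministic $g\in L^2((0,T)\times D)$, $\int_0^T\int_D g\,dW$ is a centered Gaussian variable, linear in $g$, with variance $\|g\|^2_{L^2((0,T)\times D)}$. The mild solution $u$ is that of $\partial_tu+\Delta^2u=\dot W$, $u=\Delta u=0$ on $\partial D$, $u(0,\cdot)=0$. Regularized noise: let $N_\star,J_\star\in\mathbb N$, $\Delta t=T/N_\star$, $\Delta x=1/J_\star$, $t_n=n\Delta t$, $x_j=j\Delta x$, $\mathcal N_\star=\{1,\dots,N_\star\}$, $\mathcal J_\star=\{1,\dots,J_\star\}$, $T_n=(t_{n-1},t_n)$, $D_\mu=\prod_{i=1}^d(x_{\mu_i-1},x_{\mu_i})$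 for $\mu\in\mathcal J_\star^d$, $S_{n,\mu}=T_n\times D_\mu$, $R^{n,\mu}=\int_{S_{n,\mu}}1\,dW$, and $$\widehat W(t,x)=\frac{1}{\Delta t(\Delta x)^d}\sum_{n\in\mathcal N_\star}\sum_{\mu\in\mathcal J_\star^d}\mathcal X_{S_{n,\mu}}(t,x)\,R^{n,\mu},$$ where $\mathcal X_S$ is the indicator function of $S$. The function $\widehat u$ solves $\partial_t\widehat u+\Delta^2\widehat u=\widehat W$ in $(0,T]\times D$, $\widehat u=\Delta\widehat u=0$ on $\partial D$, $\widehat u(0,\cdot)=0$. $p_d(s):=1+\sum_{i=1}^ds^i$. *)

(* Defs.v *)
From HB Require Import structures.
From mathcomp Require Import all_boot all_order all_algebra.
From mathcomp Require Import all_classical all_reals all_analysis.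
Set Implicit Arguments.
Unset Strict Implicit.
Unset Printing Implicit Defensive.
Import Order.TTheory GRing.Theory Num.Theory.
Import numFieldNormedType.Exports.
Local Open Scope classical_set_scope.
Local Open Scope ring_scope.

Section lebesgue_measure_tuple.
Context (R : realType).
Local Notation mR := (measurableTypeR R).

Definition tcons n (z : mR * n.-tuple mR) : n.+1.-tuple mR :=
  [tuple of z.1 :: z.2].

Lemma measurable_tcons n : measurable_fun [set: mR * n.-tuple mR] (@tcons n).
Proof. exact: (measurable_cons measurable_fst measurable_snd). Qed.

Lemma measurable_tuncons n : measurable_fun [set: n.+1.-tuple mR]
  (fun x => (thead x, [tuple of behead x])).
Proof.
apply/measurable_fun_pair; first exact: measurable_tnth.
exact: measurable_behead.
Qed.

Section step.
Context (n : nat) (m : {sigma_finite_measure set (n.-tuple mR) -> \bar R}).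

Definition leb_step : set (n.+1.-tuple mR) -> \bar R :=
  pushforward (lebesgue_measure \x m)%E (@tcons n).

Let mtcons := @measurable_tcons n.

Let leb_step0 : leb_step set0 = 0%E.
Proof. by rewrite /leb_step /pushforward preimage_set0 measure0. Qed.

Let leb_step_ge0 A : (0 <= leb_step A)%E.
Proof. exact: measure_ge0. Qed.

Let leb_step_sigma_additive : semi_sigma_additive leb_step.
Proof.
move=> F mF tF mUF; rewrite /leb_step /pushforward preimage_bigcup.
apply: measure_semi_sigma_additive.
- by move=> k; rewrite -[X in measurable X]setTI; exact: mtcons.
- apply/trivIsetP => /= i j _ _ ij; rewrite -preimage_setI.
  by move/trivIsetP : tF => /(_ _ _ _ _ ij) ->//; rewrite preimage_set0.
- by rewrite -preimage_bigcup -[X in measurable X]setTI; exact: mtcons.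
Qed.

HB.instance Definition _ := isMeasure.Build _ _ _ leb_step
  leb_step0 leb_step_ge0 leb_step_sigma_additive.

Let leb_step_sigma_finite : sigma_finite setT leb_step.
Proof.
have /sigma_finiteP[F [TF ndF Foo]] := sigma_finiteT (@lebesgue_measure R).
have /sigma_finiteP[G [TG ndG Goo]] := sigma_finiteT m.
exists (fun k => (fun x => (thead x, [tuple of behead x])) @^-1` (F k `*` G k)).
  rewrite -preimage_bigcup -[LHS](preimage_setT
    (fun x : n.+1.-tuple mR => (thead x, [tuple of behead x]))).
  congr (_ @^-1` _); apply/esym/seteqP; split => // -[x y] _.
  have [i _ Fx] : (\bigcup_i F i) x by rewrite -TF.
  have [j _ Gy] : (\bigcup_i G i) y by rewrite -TG.
  exists (maxn i j) => //; split => /=.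
    by move: x Fx; exact/subsetPset/ndF/leq_maxl.
  by move: y Gy; exact/subsetPset/ndG/leq_maxr.
move=> k; have [mF Fk] := Foo k; have [mG Gk] := Goo k; split.
  rewrite -[X in measurable X]setTI.
  by apply: measurable_tuncons => //; exact: measurableX.
rewrite /leb_step /pushforward -comp_preimage.
rewrite (_ : _ \o _ = id) ?preimage_id; last first.
  by apply/funext => -[x t] /=; congr pair; exact/val_inj.
by rewrite product_measure1E// lte_mul_pinfty// ge0_fin_numE.
Qed.

HB.instance Definition _ := Measure_isSigmaFinite.Build _ _ _ leb_step
  leb_step_sigma_finite.

End step.

(* n-dimensional Lebesgue measure, as iterated product measure; [leb_box] below
   is its value on boxes. *)
Fixpoint leb n : {sigma_finite_measure set (n.-tuple mR) -> \bar R} :=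
  match n with
  | 0 => \d_([tuple] : 0.-tuple mR)
  | n'.+1 => leb_step (leb n')
  end.

Lemma leb_box n (A : 'I_n -> set mR) : (forall i, measurable (A i)) ->
  leb n [set x | forall i, A i (tnth x i)] =
  (\prod_(i < n) lebesgue_measure (A i))%E.
Proof.
elim: n A => [|n IH] A mA.
  rewrite big_ord0 /= diracE mem_set//= => -[] //.
rewrite big_ord_recl -(IH (fun i => A (lift ord0 i)))// -product_measure1E//.
  congr ((_ \x _)%E _); apply/seteqP; split => -[x t] /=.
    by move=> h; split=> [|i]; [exact: (h ord0)|have := h (lift ord0 i); rewrite tnthS].
  move=> [h0 h] i; have [j ->|->//] := unliftP ord0 i.
  by rewrite tnthS; exact: h.
rewrite (_ : [set _ | _] = \bigcap_(i in [set: 'I_n]) ((fun x => tnth x i) @^-1` A (lift ord0 i))).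
  apply: fin_bigcap_measurable => // i _.
  by rewrite -[X in measurable X]setTI; exact: measurable_tnth.
by apply/seteqP; split => x /= h i; [move=> _; exact: h|exact: h].
Qed.

End lebesgue_measure_tuple.

Notation Rn R d := (d.-tuple (measurableTypeR R))%type.

Section L2.
Context (R : realType) (disp : measure_display) (T : measurableType disp).
Context (mu : {measure set T -> \bar R}).
Implicit Types (D : set T) (f : T -> R).

Definition L2norm D f : \bar R :=
  ((\int[mu]_(x in D) (`|f x| ^+ 2)%:E) `^ 2^-1)%E.

Definition in_L2 D f := measurable_fun D f /\ (L2norm D f < +oo)%E.

End L2.

Section domain.
Context (R : realType) (d : nat).
Implicit Types (t T : R) (x y : Rn R d) (alpha : 'I_d -> nat).

Definition cube : set (Rn R d) := [set x | forall i, 0 < (tnth x i : R) < 1].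

Definition closed_cube : set (Rn R d) :=
  [set x | forall i, 0 <= (tnth x i : R) <= 1].

Definition spacetime : {measure set (measurableTypeR R * Rn R d) -> \bar R} :=
  (lebesgue_measure \x leb R d)%E.

Definition cylinder T : set (measurableTypeR R * Rn R d) :=
  (`]0, T[ : set (measurableTypeR R)) `*` cube.

Definition mnorm alpha : R := Num.sqrt (\sum_(i < d) (alpha i)%:R ^+ 2).

Definition lam alpha : R := pi ^+ 2 * mnorm alpha ^+ 2.

Definition eigfun alpha x : R :=
  2 `^ (d%:R / 2) * \prod_(i < d) sin ((alpha i)%:R * pi * (tnth x i : R)).

Definition green_term t x y alpha : R :=
  expR (- (lam alpha ^+ 2) * t) * eigfun alpha x * eigfun alpha y.

(* The sum over all multi-indices with positive entries, as the limit of the sums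
   over {1, ..., K}^d: [alpha i : 'I_K] stands for the entry [(alpha i).+1].  For
   0 < t the family is absolutely summable, so the order of summation does not
   matter; the value for t <= 0 is never used. *)
Definition green t x y : R :=
  limn (fun K => \sum_(alpha : {ffun 'I_d -> 'I_K})
                   green_term t x y (fun i => (alpha i).+1)).

Definition mild_integrand t x (z : measurableTypeR R * Rn R d) : R :=
  \1_(`]0, t[ : set R) z.1 * green (t - z.1) x z.2.

End domain.
Arguments cube {R d}.
Arguments closed_cube {R d}.
Arguments spacetime {R d}.
Arguments cylinder {R d}.

(* [normal_prob m 0] is a uniform law by convention, whence the case distinction
   for the degenerate Gaussian law. *)
Definition gaussian_law (R : realType) (m s : R) : set R -> \bar R :=
  if s == 0 then \d_m else normal_prob m s.

Section noise.
Context (R : realType) (d : nat) (disp : measure_display).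
Context (Omega : measurableType disp) (P : probability Omega R).
Implicit Types (t T : R) (N J : nat) (x : Rn R d) (omega : Omega).
Implicit Types W : (measurableTypeR R * Rn R d -> R) -> Omega -> R.
Implicit Types u v : R -> Rn R d -> Omega -> R.

(* [W g] is the stochastic integral over ]0,T[ x ]0,1[^d of the deterministic
   integrand g with respect to the noise, the noise itself being A |-> W \1_A.
   Linearity makes every finite family of integrals jointly Gaussian with
   covariance the inner product of L2; in particular disjoint sets carry
   independent noise.  Integrals are only determined up to null sets, so
   linearity holds almost surely. *)
Record white_noise T W : Prop := WhiteNoise {
  white_noise_measurable : forall g, in_L2 spacetime (cylinder T) g ->
    measurable_fun setT (W g);
  white_noise_gaussian : forall g, in_L2 spacetime (cylinder T) g ->
    forall A : set R, measurable A ->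
      P (W g @^-1` A) =
      gaussian_law 0 (fine (L2norm spacetime (cylinder T) g)) A;
  white_noise_linear : forall (a : R) f g,
    in_L2 spacetime (cylinder T) f -> in_L2 spacetime (cylinder T) g ->
    {ae P, forall omega,
      W (fun z => a * f z + g z) omega = a * W f omega + W g omega} }.

(* For each (t, x) the stochastic integral is a random variable defined up to a
   null set; the mild solution is any version of this random field which is
   jointly measurable in (x, omega), as needed for the L2(D)-norm of u(t, .) to
   be a random variable. *)
Record mild_solution T W u : Prop := MildSolution {
  mild_solution_measurable : forall t, 0 <= t <= T ->
    measurable_fun (cube `*` [set: Omega]) (fun z => u t z.1 z.2);
  mild_solution_eq : forall t x, 0 <= t <= T -> closed_cube x ->
    {ae P, forall omega, u t x omega = W (mild_integrand t x) omega} }.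

Definition dt T N : R := T / N%:R.
Definition dx J : R := 1 / J%:R.

(* Indices start at 0: [cell T n mu] is the cell with indices n + 1 and
   (mu_i + 1)_i when numbering from 1. *)
Definition cell T N J (n : 'I_N) (mu : {ffun 'I_d -> 'I_J}) :
    set (measurableTypeR R * Rn R d) :=
  [set z | n%:R * dt T N < (z.1 : R) < n.+1%:R * dt T N /\
    forall i, (mu i)%:R * dx J < (tnth z.2 i : R) < (mu i).+1%:R * dx J].

Definition reg_noise T N J W (z : measurableTypeR R * Rn R d) omega : R :=
  (dt T N * dx J ^+ d)^-1 *
  \sum_(n < N) \sum_(mu : {ffun 'I_d -> 'I_J})
     \1_(cell T n mu) z * W (\1_(cell T n mu)) omega.

Definition reg_solution T N J W t x omega : R :=
  \int[spacetime]_(z in cylinder t)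
    (green (t - z.1) x z.2 * reg_noise T N J W z omega).

Definition mean_square_error u v t : \bar R :=
  ((\int[P]_omega (L2norm (leb R d) cube
       (fun x => (u t x omega - v t x omega)%R) ^+ 2)) `^ 2^-1)%E.

End noise.

Definition pd (R : realType) (d : nat) (s : R) : R :=
  1 + \sum_(1 <= i < d.+1) s ^+ i.

(* Main.v *)
Require Import Defs.
From HB Require Import structures.
From mathcomp Require Import all_boot all_order all_algebra.
From mathcomp Require Import all_classical all_reals all_analysis.
From mathcomp Require Import measurable_realfun.
From mathcomp Require Import ring lra.
Set Implicit Arguments.
Unset Strict Implicit.
Unset Printing Implicit Defensive.
Import Order.TTheory GRing.Theory Num.Theory.
Import numFieldNormedType.Exports.
Local Open Scope classical_set_scope.
Local Open Scope ring_scope.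

(** Write [g] for the integrand [mild_integrand t x] of the mild solution and
    [Pi] for the averaging over the cells of the grid, which is the orthogonal
    projection of L2 on the step functions.  The regularized solution is the
    stochastic integral of [Pi g], so by linearity the error at [(t, x)] is the
    stochastic integral of [g - Pi g], a centered Gaussian variable.  Its second
    moment is proportional to the squared norm of [g - Pi g], that is, to
    [projection_error t x], the squared norm of [g] minus that of [Pi g].

    The kernel is diagonal in the eigenfunctions: [g] is the sum over [alpha] of
    [eigfun alpha x] times [mild_coef t alpha], the product of the exponential
    [heat (rate alpha) t] in time with [eigfun alpha] in space.  Integrating over
    [x] and using orthonormality, the mean square error becomes a sum over
    [alpha] of [error_term t alpha], the squared distance of the single mode
    [mild_coef t alpha] to the step functions
    ([mean_square_errorE], [Rintegral_projection_error]).

    As [Pi] is the product of an averaging in time and one in each space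
    direction, with A and B the squared norms of the exponential and of its
    time average, and q the squared norm of the space average of the
    eigenfunction, [error_term t alpha] is A - B q = (A - B) q + A (1 - q).
    - A - B is at most the length of a time step times the total variation of
      the square of the exponential, hence at most 2 dt; it is also at most A,
      which is at most (2 rate)^-1 ([time_defect_le]).
    - 1 - q is at most the sum of the defects of the one-dimensional sines, and
      each of these is at most 1 and at most 2 (alpha_i pi dx)^2, hence at most
      a constant times (alpha_i dx)^p for every p in [0, 2]
      ([grid_defect_le]).
    The rate is at least the fourth power of the largest entry m of [alpha], and
    at most d m^(d-1) indices have this largest entry ([boxsum_max_le]).  The
    time part is thus bounded by the sum of m^(d-1) min(2 dt, m^-4 / 2), of order
    dt^((4-d)/4) ([sum_min_le]), and the space part with p = 4 - d - 2 eps by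
    dx^p times the sum of m^(-1 - 2 eps), of order 1/eps ([sum_powR_le]).

    Finally the maximum over time exists because the terms are continuous in [t]
    and bounded, uniformly in [t], by a summable family; so the sum is continuous
    ([continuous_limit_error]). *)

(** * Sums over boxes of multi-indices *)

Section box_sums.
Context (R : realType) (d : nat).
Implicit Types (F G : ('I_d -> nat) -> R) (K : nat).

(** The shift by one turns the box of [{ffun 'I_d -> 'I_K}] into the index set
    {1, ..., K}^d of the partial sums of [green]. *)
Definition multi K (alpha : {ffun 'I_d -> 'I_K}) : 'I_d -> nat :=
  fun i => (alpha i).+1.

Definition boxsum F K : R := \sum_(alpha : {ffun 'I_d -> 'I_K}) F (multi alpha).

Definition positive_index (alpha : 'I_d -> nat) := forall i, (0 < alpha i)%N.

Lemma positive_multi K (alpha : {ffun 'I_d -> 'I_K}) : positive_index (multi alpha).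
Proof. by []. Qed.
Hint Resolve positive_multi : core.

Lemma boxsum_nondecreasing F : (forall alpha, positive_index alpha -> 0 <= F alpha) ->
  nondecreasing_seq (boxsum F).
Proof.
move=> F0 K K' KK'; rewrite /boxsum.
pose h (alpha : {ffun 'I_d -> 'I_K}) : {ffun 'I_d -> 'I_K'} :=
  [ffun i => widen_ord KK' (alpha i)].
have hinj : injective h.
  move=> a b /ffunP hab; apply/ffunP => i; apply/val_inj.
  by have := hab i; rewrite !ffunE => /(congr1 val).
rewrite [leRHS](bigID (mem [set h a | a in {: {ffun 'I_d -> 'I_K}}]%SET)) /= [X in _ <= X + _]big_imset/=; last first.
  by move=> ? ? _ _; exact: hinj.
rewrite -[leLHS]addr0 lerD ?sumr_ge0//; last by move=> a _; exact: F0 (positive_multi a).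
rewrite [leRHS](eq_big xpredT (fun alpha => F (multi alpha)))// => a _.
by congr F; apply/funext => i; rewrite /multi ffunE.
Qed.

Lemma boxsumD F G K : boxsum (fun alpha => F alpha + G alpha) K =
  boxsum F K + boxsum G K.
Proof. exact: big_split. Qed.

Lemma boxsumB F G K : boxsum (fun alpha => F alpha - G alpha) K =
  boxsum F K - boxsum G K.
Proof. by rewrite /boxsum big_split/= sumrN. Qed.

Lemma boxsumZ a F K : boxsum (fun alpha => a * F alpha) K = a * boxsum F K.
Proof. by rewrite /boxsum mulr_sumr. Qed.

Lemma ler_boxsum F G K : (forall alpha : {ffun 'I_d -> 'I_K}, F (multi alpha) <= G (multi alpha)) ->
  boxsum F K <= boxsum G K.
Proof. by move=> FG; exact: ler_sum. Qed.

Lemma ler_norm_boxsum F G K :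
  (forall alpha, positive_index alpha -> `|F alpha| <= G alpha) ->
  `|boxsum F K| <= boxsum G K.
Proof. by move=> FG; rewrite (le_trans (ler_norm_sum _ _ _))// ler_sum// => a _; exact: FG. Qed.

(** Box sums of the nonnegative families [G - F] and [G + F] are nondecreasing:
    this is what stands for absolute summability over all multi-indices. *)
Lemma boxsum_tail F G K K' : (K <= K')%N ->
  (forall alpha, positive_index alpha -> `|F alpha| <= G alpha) ->
  `|boxsum F K' - boxsum F K| <= boxsum G K' - boxsum G K.
Proof.
move=> KK' FG.
have h1 : boxsum (fun a => G a - F a) K <= boxsum (fun a => G a - F a) K'.
  apply: boxsum_nondecreasing => // a a0.
  by have := FG a a0; rewrite ler_norml; lra.
have h2 : boxsum (fun a => G a + F a) K <= boxsum (fun a => G a + F a) K'.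
  apply: boxsum_nondecreasing => // a a0.
  by have := FG a a0; rewrite ler_norml; lra.
move: h1 h2; rewrite !boxsumB !boxsumD ler_norml; lra.
Qed.

Lemma is_cvg_boxsum_ge0 G Z : (forall alpha, positive_index alpha -> 0 <= G alpha) ->
  (forall K, boxsum G K <= Z) -> cvgn (boxsum G).
Proof.
move=> G0 GZ; apply: nondecreasing_is_cvgn; first exact: boxsum_nondecreasing.
by exists Z => _ [K _ <-].
Qed.

Lemma is_cvg_boxsum F G Z :
  (forall alpha, positive_index alpha -> `|F alpha| <= G alpha) ->
  (forall K, boxsum G K <= Z) -> cvgn (boxsum F).
Proof.
move=> FG GZ; have G0 a : positive_index a -> 0 <= G a.
  by move=> a0; exact: le_trans (normr_ge0 _) (FG a a0).
have -> : boxsum F = boxsum (fun a => G a + F a) - boxsum G.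
  by apply/funext => K; rewrite fctE boxsumD addrC addKr.
apply: is_cvgB; last exact: is_cvg_boxsum_ge0 GZ.
apply: (@is_cvg_boxsum_ge0 _ (Z + Z)).
  by move=> a a0; have := FG a a0; rewrite ler_norml; lra.
move=> K; rewrite boxsumD lerD// (le_trans _ (GZ K))//.
by rewrite (le_trans (ler_norm _))// ler_norm_boxsum.
Qed.

Lemma lim_boxsum_tail F G Z K :
  (forall alpha, positive_index alpha -> `|F alpha| <= G alpha) ->
  (forall K, boxsum G K <= Z) ->
  `|limn (boxsum F) - boxsum F K| <= limn (boxsum G) - boxsum G K.
Proof.
move=> FG GZ; have G0 a : positive_index a -> 0 <= G a.
  by move=> a0; exact: le_trans (normr_ge0 _) (FG a a0).
have cF := is_cvg_boxsum FG GZ; have cG := is_cvg_boxsum_ge0 G0 GZ.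
have c1 : `|boxsum F K' - boxsum F K| @[K' --> \oo] --> `|limn (boxsum F) - boxsum F K|.
  by apply: cvg_norm; apply: cvgB => //; exact: cvg_cst.
have c2 : boxsum G K' - boxsum G K @[K' --> \oo] --> limn (boxsum G) - boxsum G K.
  by apply: cvgB => //; exact: cvg_cst.
rewrite -(cvg_lim _ c1)// -(cvg_lim _ c2)//.
apply: ler_lim; [by apply/cvg_ex; eexists; exact: c1|by apply/cvg_ex; eexists; exact: c2|].
by exists K => // K' KK'; exact: boxsum_tail.
Qed.

(** At most [d * m ^ (d - 1)] indices have largest entry [m]: there are [d]
    places for an entry equal to [m], and at most [m] values for each of the
    others. *)
Lemma boxsum_max_le F (f : nat -> R) K : (0 < d)%N -> (forall m, 0 <= f m) ->
  (forall alpha i, positive_index alpha -> (forall j, alpha j <= alpha i)%N ->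
    F alpha <= f (alpha i)) ->
  boxsum F K <= d%:R * \sum_(m < K) m.+1%:R ^+ d.-1 * f m.+1.
Proof.
move=> d0 f0 Ff.
(* the product over j of w i m j is the indicator of the indices with i-th entry
   m and no larger entry; being a product, it is easily summed over the box *)
pose w (i : 'I_d) (m : 'I_K) (j : 'I_d) (k : 'I_K) : R :=
  if j == i then (k == m)%:R else (k <= m)%N%:R.
have w0 i m j k : 0 <= w i m j k by rewrite /w; case: ifP; rewrite ler0n.
have ws i m : \sum_(alpha : {ffun 'I_d -> 'I_K}) \prod_j w i m j (alpha j) =
    m.+1%:R ^+ d.-1.
  rewrite -(bigA_distr_bigA (w i m)) (bigD1 i)//= {1}/w eqxx.
  rewrite (bigD1 m)//= eqxx big1 ?addr0 ?mul1r => [|k /negbTE ->//].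
  rewrite (eq_bigr (fun=> m.+1%:R)) => [|j /negbTE ji].
    by rewrite prodr_const cardC1 card_ord.
  rewrite /w ji -natr_sum; congr _%:R.
  rewrite (eq_bigr (fun k : 'I_K => if (k < m.+1)%N then 1 else 0)%N); last first.
    by move=> k _; rewrite ltnS; case: (k <= m)%N.
  rewrite -big_mkcond/= -(big_ord_widen _ (fun=> 1%N))//.
  by rewrite sum1_card card_ord.
have key (alpha : {ffun 'I_d -> 'I_K}) : F (multi alpha) <=
    \sum_i \sum_(m < K) f m.+1 * \prod_j w i m j (alpha j).
  have [i _ imax] := @arg_maxnP _ (Ordinal d0) xpredT (fun i => nat_of_ord (alpha i)) isT.
  apply: (le_trans (Ff (multi alpha) i _ _)); [by []|by move=> j; rewrite /multi ltnS; exact: imax|].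
  rewrite (bigD1 i)//= (bigD1 (alpha i))//= big1 => [|j _]; last first.
    rewrite /w; case: ifPn => [/eqP ->|_]; first by rewrite eqxx.
    by have -> : (alpha j <= alpha i)%N by exact: imax.
  rewrite mulr1 -addrA lerDl addr_ge0// sumr_ge0// => [m _|j _].
    by rewrite mulr_ge0// prodr_ge0.
  by rewrite sumr_ge0// => m _; rewrite mulr_ge0// prodr_ge0.
apply: (@le_trans _ _ (\sum_(alpha : {ffun 'I_d -> 'I_K})
    \sum_i \sum_(m < K) f m.+1 * \prod_j w i m j (alpha j))).
  exact: ler_sum.
rewrite exchange_big/= (eq_bigr (fun=> \sum_(m < K) m.+1%:R ^+ d.-1 * f m.+1)).
  by rewrite sumr_const card_ord mulr_natl.
move=> i _; rewrite exchange_big/=; apply: eq_bigr => m _.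
by rewrite -mulr_sumr ws mulrC.
Qed.

End box_sums.

(** * One-dimensional sums of powers *)

Section power_sums.
Context (R : realType).

Lemma ler_sum_telescope (f g : nat -> R) n : (forall i, f i <= g i.+1 - g i) ->
  \sum_(i < n) f i <= g n - g 0%N.
Proof.
move=> fg; rewrite -(telescope_sumr g (leq0n n)) big_mkord.
exact: ler_sum.
Qed.

(** In terms of x = m b the m-th term is at most 8 b^(5-d) / (1 + x)^2: it is
    small for x <= 1 because of the factor x^(d-1) and decreases at least like
    x^-2 for x >= 1.  The bound is dominated by an increment of
    - 8 b^(4-d) / (1 + x), so the sum telescopes. *)
Lemma sum_min_le (d : nat) (hd : d = 2%N \/ d = 3%N) (b : R) K : 0 < b ->
  \sum_(m < K) m.+1%:R ^+ d.-1 * Num.min (2 * b ^+ 4) ((2 * m.+1%:R ^+ 4)^-1)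
  <= 8 * b ^+ (4 - d).
Proof.
move=> b0.
pose g (m : nat) : R := - (8 * b ^+ (4 - d)) / (1 + m%:R * b).
apply: (@le_trans _ _ (g K - g 0%N)); last first.
  rewrite /g mul0r addr0 divr1 mulNr opprK gerDr oppr_le0.
  rewrite divr_ge0// ?mulr_ge0// ?exprn_ge0//; try exact: ltW.
  by rewrite addr_ge0// mulr_ge0// ltW.
apply: (@ler_sum_telescope (fun m : nat => m.+1%:R ^+ d.-1 *
  Num.min (2 * b ^+ 4) ((2 * m.+1%:R ^+ 4)^-1)) g) => m.
have m0 : 0 <= m%:R :> R by [].
set n : R := m.+1%:R.
have n0 : 0 < n by rewrite ltr0n.
have mn : m%:R = n - 1 :> R by rewrite /n -natr1 addrK.
have n1 : 1 <= n by rewrite ler1n.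
have nE : m.+1%:R = n by []; clearbody n.
have h : 0 < 1 + (n - 1) * b by rewrite ltr_pwDl// mulr_ge0 ?subr_ge0// ltW.
have h' : 0 < 1 + n * b by rewrite ltr_pwDl// mulr_ge0 ?ltW.
have h0 : 1 + (n - 1) * b != 0 by rewrite gt_eqF.
have h0' : 1 + n * b != 0 by rewrite gt_eqF.
apply: (@le_trans _ _ (8 * b ^+ (4 - d) * b / (1 + n * b) ^+ 2)); last first.
  rewrite /g nE mn.
  have -> : - (8 * b ^+ (4 - d)) / (1 + n * b) - - (8 * b ^+ (4 - d)) / (1 + (n - 1) * b)
      = 8 * b ^+ (4 - d) * b * (1 + n * b)^-1 / (1 + (n - 1) * b).
    by field; rewrite h0 h0'.
  rewrite expr2 invfM mulrA ler_wpM2l//.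
    by rewrite divr_ge0 ?mulr_ge0 ?exprn_ge0 ?ltW.
  rewrite lef_pV2 ?posrE// lerD2l ler_wpM2r; [by []|exact: ltW|].
  by rewrite gerBl.
have [nb|nb] := leP (n * b) 1.
- apply: (@le_trans _ _ (n ^+ d.-1 * (2 * b ^+ 4))).
    by rewrite ler_wpM2l ?(exprn_ge0, ltW n0)// ge_min lexx.
  rewrite ler_pdivlMr ?exprn_gt0//.
  have h4 : (1 + n * b) ^+ 2 <= 4.
    have -> : 4 = 2 ^+ 2 :> R by rewrite -natrX.
    rewrite ler_sqr ?nnegrE ?(ltW h')//; lra.
  apply: (@le_trans _ _ (n ^+ d.-1 * (2 * b ^+ 4) * 4)).
    by rewrite ler_wpM2l// !(mulr_ge0, exprn_ge0, ltW n0, ltW b0).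
  case: hd => -> /=; rewrite ?subSS ?subn0.
    have : n * b * b ^+ 3 <= 1 * b ^+ 3 by rewrite ler_wpM2r// ?(exprn_ge0, ltW b0).
    by rewrite /=; lra.
  have : (n * b) ^+ 2 * b ^+ 2 <= 1 * b ^+ 2.
    by rewrite ler_wpM2r ?(exprn_ge0, ltW b0)// exprn_ile1// mulr_ge0 ?ltW.
  by rewrite /=; lra.
- apply: (@le_trans _ _ (n ^+ d.-1 * (2 * n ^+ 4)^-1)).
    by rewrite ler_wpM2l ?(exprn_ge0, ltW n0)// ge_min lexx orbT.
  rewrite ler_pdivlMr ?exprn_gt0// mulrAC ler_pdivrMr ?mulr_gt0 ?exprn_gt0//.
  have h4 : (1 + n * b) ^+ 2 <= 4 * (n * b) ^+ 2.
    have -> : 4 * (n * b) ^+ 2 = (2 * (n * b)) ^+ 2 by ring.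
    rewrite ler_sqr ?nnegrE ?(ltW h') ?mulr_ge0 ?(ltW n0) ?(ltW b0)//; lra.
  apply: (@le_trans _ _ (n ^+ d.-1 * (4 * (n * b) ^+ 2))).
    by rewrite ler_wpM2l// exprn_ge0 ?(ltW n0).
  have p3 : 0 <= n ^+ 3 * b ^+ 2 by rewrite mulr_ge0 ?exprn_ge0 ?ltW.
  case: hd => -> /=; rewrite ?subSS ?subn0.
    have : n ^+ 3 * b ^+ 2 * 1 <= n ^+ 3 * b ^+ 2 * (n * b) by rewrite ler_wpM2l// (ltW nb).
    by rewrite /=; nra.
  have p4 : 0 <= n ^+ 4 * b ^+ 2 by rewrite mulr_ge0 ?exprn_ge0 ?ltW.
  by rewrite /=; nra.
Qed.

(** Comparison with the increments of - m^-p / p, which rests on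
    (1 - 1/m)^-p >= 1 + p/m. *)
Lemma sum_powR_le (p : R) K : 0 < p ->
  \sum_(m < K) m.+1%:R `^ (- (1 + p)) <= 1 + p^-1.
Proof.
move=> p0; case: K => [|K]; first by rewrite big_ord0 addr_ge0// invr_ge0 ltW.
rewrite big_ord_recl/= powR1 lerD2l.
pose g (m : nat) : R := - (p^-1 * m.+1%:R `^ (- p)).
apply: (@le_trans _ _ (g K - g 0%N)); last first.
  rewrite /g powR1 mulr1 opprK gerDr oppr_le0.
  by rewrite mulr_ge0 ?powR_ge0 ?invr_ge0 ?ltW.
apply: (@ler_sum_telescope (fun i : nat => (bump 0 i).+1%:R `^ (- (1 + p))) g) => m.
rewrite /bump leq0n add1n.
have -> : g m.+1 - g m = p^-1 * (m.+1%:R `^ (- p) - m.+2%:R `^ (- p)) by rewrite /g; ring.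
set n : R := m.+2%:R; set n' : R := m.+1%:R.
have n0 : 0 < n by rewrite ltr0n.
have n'0 : 0 < n' by rewrite ltr0n.
have nn : n' = n - 1 by rewrite /n -natr1 addrK.
rewrite ler_pdivlMl//.
rewrite opprD powRD; last by apply/implyP => _; rewrite gt_eqF.
rewrite powR_inv1 ?(ltW n0)//.
have nE : 1 < n by rewrite ltr1n.
clearbody n n'.
have -> : n' `^ (- p) = n `^ (- p) * (n' / n) `^ (- p).
  by rewrite -powRM ?divr_ge0 ?ltW// mulrCA divff ?mulr1// gt_eqF.
suff h : p * n^-1 <= (n' / n) `^ (- p) - 1.
  by have := ler_wpM2l (powR_ge0 n (- p)) h; lra.
rewrite /powR ifF; last by rewrite gt_eqF// divr_gt0.
have h1 : n^-1 <= - ln (n' / n).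
  have := @le_ln1Dx _ (- n^-1).
  have e : 1 - n^-1 = n' / n by rewrite nn mulrBl divff ?mul1r// gt_eqF.
  rewrite e => /(_ _)/wrap[]; last by lra.
  by rewrite ltrN2 invf_lt1.
apply: (@le_trans _ _ (- p * ln (n' / n))).
  by rewrite mulNr -mulrN; apply: ler_wpM2l h1; exact: ltW.
have := expR_ge1Dx (- p * ln (n' / n)); lra.
Qed.

End power_sums.

(** * Real-valued integrals *)

Section real_integrals.
Context {dT : measure_display} {T : measurableType dT} {R : realType}.
Context (mu : {measure set T -> \bar R}) (D : set T) (mD : measurable D).
Local Notation integ f := (mu.-integrable D (EFin \o f)).

Lemma integrable_bigsum (I : Type) (s : seq I) (f : I -> T -> R) :
  (forall i, integ (f i)) -> integ (fun x => \sum_(i <- s) f i x).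
Proof.
move=> intf.
have -> : EFin \o (fun x => \sum_(i <- s) f i x) =
    (fun x => \sum_(i <- s) (EFin \o f i) x)%E.
  by apply/funext => x /=; rewrite sumEFin.
exact: integrable_sum.
Qed.

Lemma Rintegral_bigsum (I : Type) (s : seq I) (f : I -> T -> R) :
  (forall i, integ (f i)) ->
  \int[mu]_(x in D) (\sum_(i <- s) f i x) = \sum_(i <- s) \int[mu]_(x in D) f i x.
Proof.
move=> intf; elim: s => [|i s IH].
  under eq_Rintegral do rewrite big_nil.
  by rewrite Rintegral_cst// mul0r big_nil.
under eq_Rintegral do rewrite big_cons.
by rewrite RintegralD// ?IH ?big_cons//; exact: integrable_bigsum.
Qed.

Lemma integrableZ_EFin (a : R) (f : T -> R) : integ f -> integ (fun x => a * f x).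
Proof.
by move=> intf; apply: (@integrableZl _ _ _ mu D mD a (EFin \o f)).
Qed.

Lemma integrableD_EFin (f g : T -> R) : integ f -> integ g -> integ (fun x => f x + g x).
Proof. by move=> intf intg; exact: (integrableD mD intf intg). Qed.

Lemma integrableB_EFin (f g : T -> R) : integ f -> integ g -> integ (fun x => f x - g x).
Proof. by move=> intf intg; exact: (integrableB mD intf intg). Qed.

Lemma le_integrable_EFin (f g : T -> R) : measurable_fun D f ->
  (forall x, D x -> `|f x| <= g x) -> integ g -> integ f.
Proof.
move=> mf fg; apply: le_integrable => //; first exact/measurable_EFinP.
by move=> x Dx /=; rewrite lee_fin (le_trans (fg _ Dx))// ler_norm.
Qed.

Lemma integrable_patch (S : set T) (f : T -> R) : measurable S ->
  integ f -> integ (f \_ S).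
Proof.
move=> mS intf; rewrite -restrict_EFin; apply/integrable_restrict => //.
by apply: (integrableS mD _ _ intf); [exact: measurableI|exact: subIsetl].
Qed.

Lemma bounded_integrable_EFin (f : T -> R) (M : R) : (mu D < +oo)%E ->
  measurable_fun D f -> (forall x, D x -> `|f x| <= M) -> integ f.
Proof.
move=> Doo mf fM; apply: le_integrable_EFin mf fM _.
apply: measurable_bounded_integrable => //.
by exists `|M|; split; [exact: num_real|move=> x Mx y _ /=; exact: ltW].
Qed.

Lemma EFin_Rintegral (f : T -> R) : integ f ->
  (\int[mu]_(x in D) (f x)%:E)%E = (\int[mu]_(x in D) f x)%:E.
Proof. by move=> intf; rewrite /Rintegral fineK//; exact: integrable_fin_num. Qed.

Lemma dominated_cvg_Rintegral (f_ : (T -> R)^nat) (f g : T -> R) :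
  (forall n, measurable_fun D (f_ n)) ->
  (forall x, D x -> f_ ^~ x @ \oo --> f x) ->
  integ g -> (forall n x, D x -> `|f_ n x| <= g x) ->
  integ f /\ \int[mu]_(x in D) f_ n x @[n --> \oo] --> \int[mu]_(x in D) f x.
Proof.
move=> mf ff intg fg.
have mf' : measurable_fun D f by exact: measurable_fun_cvg ff.
have ffE x : D x -> (EFin \o f_ n) x @[n --> \oo] --> (EFin \o f) x.
  by move=> Dx; apply: cvg_EFin; [exact: nearW|exact: ff].
have [intf _ cvgf] := @dominated_convergence _ _ _ mu D mD
  (fun n => EFin \o f_ n) (EFin \o f) (EFin \o g)
  (fun n => (measurable_EFinP _ _).2 (mf n)) ((measurable_EFinP _ _).2 mf')
  (aeW _ ffE)
  intg (aeW _ (fun x n Dx => fg n x Dx)).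
split => //.
have fE n : (\int[mu]_(x in D) (f_ n x)%:E)%E = (\int[mu]_(x in D) f_ n x)%:E.
  by rewrite EFin_Rintegral//; apply: le_integrable_EFin intg => // x Dx; exact: fg.
move: cvgf; rewrite (EFin_Rintegral intf) => /fine_cvg /=.
exact.
Qed.

End real_integrals.

(** * Integrals over products of sets *)

Section product_integrals.
Context {d1 d2 : measure_display} {T1 : measurableType d1} {T2 : measurableType d2}.
Context {R : realType}.
Context (m1 : {sigma_finite_measure set T1 -> \bar R}).
Context (m2 : {sigma_finite_measure set T2 -> \bar R}).
Context (A : set T1) (B : set T2) (mA : measurable A) (mB : measurable B).

Let patchX (F : T1 * T2 -> \bar R) x y : (F \_ (A `*` B)) (x, y) =
  ((fun x => ((fun y => F (x, y)) \_ B) y) \_ A) x.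
Proof.
rewrite /patch; case: ifPn => [/set_mem[/= Ax By]|/negP AB].
  by rewrite !mem_set.
case: ifPn => // /set_mem Ax; case: ifPn => // /set_mem By.
by case: AB; apply/mem_set.
Qed.

Lemma fubini_tonelli_setX1 (F : T1 * T2 -> \bar R) :
  measurable_fun (A `*` B) F -> (forall z, (A `*` B) z -> 0 <= F z)%E ->
  (\int[m1 \x m2]_(z in A `*` B) F z = \int[m1]_(x in A) \int[m2]_(y in B) F (x, y))%E.
Proof.
move=> mF F0; have mAB : measurable (A `*` B) by exact: measurableX.
rewrite integral_mkcond fubini_tonelli1/=; first last.
- by apply: erestrict_ge0.
- exact/(measurable_restrictT _ _).1.
rewrite [RHS]integral_mkcond; apply: eq_integral => x _.
rewrite /fubini_F; under eq_integral do rewrite patchX.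
rewrite /patch; case: ifPn => xA; first by rewrite [RHS]integral_mkcond.
by rewrite integral0.
Qed.

Lemma fubini_tonelli_setX2 (F : T1 * T2 -> \bar R) :
  measurable_fun (A `*` B) F -> (forall z, (A `*` B) z -> 0 <= F z)%E ->
  (\int[m1 \x m2]_(z in A `*` B) F z = \int[m2]_(y in B) \int[m1]_(x in A) F (x, y))%E.
Proof.
move=> mF F0; have mAB : measurable (A `*` B) by exact: measurableX.
rewrite integral_mkcond fubini_tonelli2/=; first last.
- by apply: erestrict_ge0.
- exact/(measurable_restrictT _ _).1.
rewrite [RHS]integral_mkcond; apply: eq_integral => y _.
rewrite /fubini_G; under eq_integral do rewrite patchX.
rewrite /patch; case: ifPn => yB.
  by rewrite [RHS]integral_mkcond; apply: eq_integral => x _; rewrite /patch; case: ifPn.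
by under eq_integral do rewrite if_same; rewrite integral0.
Qed.

Lemma measurable_fun_setX (f : T1 -> R) (g : T2 -> R) :
  measurable_fun A f -> measurable_fun B g ->
  measurable_fun (A `*` B) (fun z => f z.1 * g z.2).
Proof.
move=> mf mg; apply: measurable_funM.
- apply: (@measurable_comp _ _ _ _ _ _ A f _ fst) => //; last exact: measurable_funTS.
  by move=> _ [z [] ? _ <-].
- apply: (@measurable_comp _ _ _ _ _ _ B g _ snd) => //; last exact: measurable_funTS.
  by move=> _ [z [] ? ? <-].
Qed.

Lemma integrable_setX (f : T1 -> R) (g : T2 -> R) :
  m1.-integrable A (EFin \o f) -> m2.-integrable B (EFin \o g) ->
  (m1 \x m2)%E.-integrable (A `*` B) (EFin \o (fun z => f z.1 * g z.2)).
Proof.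
move=> /integrableP[/measurable_EFinP mf intf] /integrableP[/measurable_EFinP mg intg].
have mfg := measurable_fun_setX mf mg.
apply/integrableP; split; first exact/measurable_EFinP.
rewrite fubini_tonelli_setX1//; last by apply/measurable_EFinP/measurableT_comp.
rewrite (eq_integral (fun x => `|f x|%:E * \int[m2]_(y in B) `|g y|%:E)%E).
  rewrite ge0_integralZr//; last 2 first.
  - by apply/measurable_EFinP/measurableT_comp.
  - exact: integral_ge0.
  by rewrite lte_mul_pinfty// ?integral_ge0// ge0_fin_numE// integral_ge0.
move=> x _ /=; rewrite -ge0_integralZl//=.
- by apply: eq_integral => y _; rewrite normrM EFinM.
- by apply/measurable_EFinP/measurableT_comp.
Qed.

Lemma Rintegral_setX (f : T1 -> R) (g : T2 -> R) :
  m1.-integrable A (EFin \o f) -> m2.-integrable B (EFin \o g) ->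
  \int[(m1 \x m2)%E]_(z in A `*` B) (f z.1 * g z.2) =
  (\int[m1]_(x in A) f x) * (\int[m2]_(y in B) g y).
Proof.
move=> intf intg; have intfg := integrable_setX intf intg.
apply/EFin_inj; rewrite -EFin_Rintegral//; last exact: measurableX.
rewrite integral_mkcond -integral12_prod_meas1; last first.
  by apply/(integrable_mkcond _ (measurableX mA mB)).1.
rewrite EFinM -!EFin_Rintegral//.
rewrite -(fineK (integrable_fin_num mB intg)) -integralZr//.
rewrite [RHS]integral_mkcond; apply: eq_integral => x _.
rewrite /fubini_F; under eq_integral do rewrite patchX.
rewrite /patch; case: ifPn => xA; last by rewrite integral0.
rewrite -integral_mkcond fineK ?integrable_fin_num//.
by rewrite -integralZl.
Qed.

End product_integrals.

(** * Integrals over boxes *)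

Section leb_integrals.
Context {R : realType}.
Local Notation mR := (measurableTypeR R).
Local Notation lebR := (@lebesgue_measure R).

Definition box n (A : 'I_n -> set mR) : set (n.-tuple mR) :=
  [set x | forall i, A i (tnth x i)].

Lemma measurable_box n (A : 'I_n -> set mR) : (forall i, measurable (A i)) ->
  measurable (box A).
Proof.
move=> mA; rewrite (_ : box A = \bigcap_(i in [set: 'I_n]) ((fun x => tnth x i) @^-1` A i)).
  apply: fin_bigcap_measurable => // i _.
  by rewrite -[X in measurable X]setTI; exact: measurable_tnth.
by apply/seteqP; split => x /= h i; [move=> _; exact: h|exact: h].
Qed.

Lemma measurable_prod_tnth n (f : 'I_n -> mR -> R) (A : 'I_n -> set mR) :
  (forall i, measurable (A i)) ->
  (forall i, measurable_fun (A i) (f i)) ->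
  measurable_fun (box A) (fun x : n.-tuple mR => \prod_(i < n) f i (tnth x i)).
Proof.
move=> mA mf; apply: measurable_prod => i _.
apply: (@measurable_comp _ _ _ _ _ _ (A i) (f i) _ (fun x => tnth x i)) => //.
  by move=> _ [x h <-]; exact: h.
by apply: measurable_funTS; exact: measurable_tnth.
Qed.

(** Fubini along the recursive definition of [leb] as the image of a product
    measure. *)
Lemma leb_box_integral n (f : 'I_n -> mR -> R) (A : 'I_n -> set mR) :
  (forall i, measurable (A i)) -> (forall i, lebR.-integrable (A i) (EFin \o f i)) ->
  (leb R n).-integrable (box A) (EFin \o (fun x => \prod_(i < n) f i (tnth x i))) /\
  \int[leb R n]_(x in box A) (\prod_(i < n) f i (tnth x i)) =
  \prod_(i < n) \int[lebR]_(y in A i) f i y.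
Proof.
elim: n f A => [|n IH] f A mA intf.
  have fE : (fun x : 0.-tuple mR => \prod_(i < 0) f i (tnth x i)) = cst 1.
    by apply/funext => x; rewrite big_ord0.
  have AE : box A = setT by apply/seteqP; split => // x _ [].
  have leb1 : leb R 0 (box A) = 1%E by rewrite AE /= diracE mem_set.
  have oo : (leb R 0 (box A) < +oo)%E.
    exact: (@eq_ind_r _ 1%E (fun z => (z < +oo)%E) (ltry _) _ leb1).
  rewrite fE; split; first by apply: (@bounded_integrable_EFin _ _ _ _ _ (measurable_box mA) (cst 1) `|1|).
  rewrite Rintegral_cst; last exact: measurable_box.
  by rewrite big_ord0 mul1r; exact: (congr1 fine leb1).
pose f' i := f (lift ord0 i); pose A' i := A (lift ord0 i).
have [intf' intE] := IH f' A' (fun i => mA _) (fun i => intf _).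
have mA' : measurable (box A') by apply: measurable_box => i; exact: mA.
pose F (x : n.+1.-tuple mR) : R := \prod_(i < n.+1) (f i \_ (A i)) (tnth x i).
have preE : tcons (n:=n) @^-1` box A = A ord0 `*` box A'.
  apply/seteqP; split => -[x t] /=.
    move=> h; split; first exact: (h ord0).
    by move=> i; have := h (lift ord0 i); rewrite tnthS.
  move=> [h0 h] i; have [j ->|->//] := unliftP ord0 i.
  by rewrite tnthS; exact: h.
have FE x : box A x -> F x = \prod_(i < n.+1) f i (tnth x i).
  by move=> Ax; apply: eq_bigr => i _; rewrite /patch mem_set.
have Ftcons z : (A ord0 `*` box A') z -> F (tcons z) = f ord0 z.1 * \prod_(i < n) f' i (tnth z.2 i).
  move=> zA; rewrite FE.
    by rewrite big_ord_recl; congr *%R; apply: eq_bigr => i _; rewrite tnthS.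
  by move: zA; rewrite -preE.
have mF : measurable_fun setT (EFin \o F).
  apply/measurable_EFinP; apply: measurable_prod => i _.
  apply: (@measurable_comp _ _ _ _ _ _ setT (f i \_ (A i)) _ (fun x => tnth x i)) => //.
    apply/(measurable_restrictT _ _).1 => //.
    by have /integrableP[/measurable_EFinP] := intf i.
  exact: measurable_tnth.
have mAA : measurable (A ord0 `*` box A') by exact: measurableX.
have int1 := integrable_setX (mA ord0) mA' (intf ord0) intf'.
have int2 : (lebR \x leb R n)%E.-integrable (tcons (n:=n) @^-1` box A) ((EFin \o F) \o tcons (n:=n)).
  rewrite preE; apply: eq_integrable int1 => // z /set_mem zA /=.
  by rewrite Ftcons.
have mbA : measurable (box A) by exact: measurable_box.
have int3 : (leb R n.+1).-integrable (box A) (EFin \o F) :=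
  integrable_pushforward (@measurable_tcons R n) mF int2 mbA.
have int4 : (leb R n.+1).-integrable (box A) (EFin \o (fun x => \prod_(i < n.+1) f i (tnth x i))).
  by apply: eq_integrable int3 => // x /set_mem xA /=; rewrite FE.
split => //.
apply/EFin_inj; rewrite -EFin_Rintegral//.
transitivity (\int[leb R n.+1]_(x in box A) (F x)%:E)%E.
  by apply: eq_integral => x /set_mem xA; rewrite FE.
transitivity (\int[(lebR \x leb R n)%E]_(z in tcons (n:=n) @^-1` box A) ((EFin \o F) \o tcons (n:=n)) z)%E.
  exact: (integral_pushforward (@measurable_tcons R n) mF int2 mbA).
rewrite preE big_ord_recl -intE -Rintegral_setX// -EFin_Rintegral//.
by apply: eq_integral => z /set_mem zA /=; rewrite Ftcons.
Qed.

End leb_integrals.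

(** * Exponentials and sines on an interval *)

Section interval_integrals.
Context {R : realType}.
Local Notation mR := (measurableTypeR R).
Local Notation lebR := (@lebesgue_measure R).

Definition oo (a b : R) : set mR := [set` `]a, b[].

Lemma measurable_oo a b : measurable (oo a b).
Proof. exact: measurable_itv. Qed.
Hint Resolve measurable_oo : core.

Lemma lebesgue_measure_oo a b : a <= b -> lebR (oo a b) = (b - a)%:E.
Proof.
move=> ab; rewrite lebesgue_measure_itv/= lte_fin; case: ltP => // ba.
have -> : b = a by apply/eqP; rewrite eq_le ab ba.
by rewrite subrr.
Qed.

Lemma lebesgue_measure_oo_lty a b : (lebR (oo a b) < +oo)%E.
Proof. by rewrite lebesgue_measure_itv/=; case: ifP => // _; rewrite ?ltry. Qed.

Lemma integrable_oo (f : R -> R) a b : continuous f ->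
  lebR.-integrable (oo a b) (EFin \o f).
Proof.
move=> cf; have : lebR.-integrable ([set` `[a, b]] : set mR) (EFin \o f).
  apply: continuous_compact_integrable; first exact: segment_compact.
  exact: continuous_subspaceT.
apply: integrableS; [exact: measurable_itv|exact: measurable_itv|].
by apply: subset_itv; rewrite bnd_simp.
Qed.

Lemma Rintegral_FTC (f F : R -> R) a b : a <= b -> continuous f ->
  (forall x, is_derive x (1 : R) F (f x)) ->
  \int[lebR]_(x in oo a b) f x = F b - F a.
Proof.
rewrite le_eqVlt => /predU1P[<-|ab] cf dF.
  by rewrite /oo set_itvoo0 Rintegral_set0 subrr.
have cF : continuous F.
  by move=> x; apply/differentiable_continuous/derivable1_diffP; have [] := dF x.
apply/EFin_inj; rewrite -EFin_Rintegral//; last exact: integrable_oo.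
rewrite -(@integral_itv_bndoo _ _ _ _ true false); last first.
  by apply/measurable_EFinP/measurable_funTS; exact: continuous_measurable_fun.
rewrite (@continuous_FTC2 _ f F)//; first exact: continuous_subspaceT.
- split; first by move=> x _; have [] := dF x.
    exact/cvg_at_right_filter/cF.
  exact/cvg_at_left_filter/cF.
- by move=> x _; rewrite derive1E; have [_ ->] := dF x.
Qed.

Lemma is_derive_scale (f : R -> R) (df c x : R) :
  is_derive (c * x) (1 : R) f df ->
  is_derive x (1 : R) (fun y => f (c * y)) (c * df).
Proof.
move=> fd; have idc : is_derive x (1 : R) (fun y : R => c * y) c.
  by apply: is_derive_eq; rewrite /GRing.scale/= mulr1.
by have := @is_derive1_comp R f ( *%R c) x df c fd idc; rewrite mulrC.
Qed.

Definition heat (L t s : R) : R := \1_(oo 0 t) s * expR (- L * (t - s)).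

(** The closed formula for the integral of [heat L t] over ]p, q[; the minima
    account for the cut at time [t], so that one formula, continuous in [t],
    covers all positions of [t]. *)
Definition heat_int (L t p q : R) : R :=
  (expR (- L * (t - Num.min q t)) - expR (- L * (t - Num.min p t))) / L.

Lemma continuous_expR_affine (L t : R) : continuous (fun s : R => expR (- L * (t - s))).
Proof.
move=> x; apply: continuous_comp; last exact: continuous_expR.
apply: cvgM; first exact: cvg_cst.
by apply: cvgB; [exact: cvg_cst|exact: cvg_id].
Qed.

Lemma measurable_heat L t : measurable_fun setT (heat L t : mR -> R).
Proof.
apply: measurable_funM; first exact: measurable_indic.
by apply: continuous_measurable_fun; exact: continuous_expR_affine.
Qed.

Lemma heat_ge0 L t s : 0 <= heat L t s.
Proof. by rewrite /heat mulr_ge0// expR_ge0. Qed.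

Lemma heat_le1 L t s : 0 <= L -> heat L t s <= 1.
Proof.
move=> L0; rewrite /heat indicE; case: (boolP (s \in _)) => [/set_mem|_]; last by rewrite mul0r.
rewrite /oo/= in_itv/= => /andP[s0 st]; rewrite mul1r -expR0 ler_expR.
by rewrite mulNr oppr_le0 mulr_ge0// subr_ge0 ltW.
Qed.

Lemma heat_sqr L t s : heat L t s ^+ 2 = heat (2 * L) t s.
Proof.
rewrite /heat expr2 mulrACA -expRD indicE; case: (_ \in _); rewrite ?mul0r// !mul1r.
by congr expR; ring.
Qed.

Lemma integrable_heat L t p q : 0 <= L -> lebR.-integrable (oo p q) (EFin \o heat L t).
Proof.
move=> L0; apply: (@bounded_integrable_EFin _ _ _ _ _ _ _ 1) => //.
- exact: lebesgue_measure_oo_lty.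
- by apply: measurable_funTS; exact: measurable_heat.
- by move=> s _; rewrite ger0_norm ?heat_ge0 ?heat_le1.
Qed.

Lemma Rintegral_heat L t p q : 0 < L -> 0 <= p <= q ->
  \int[lebR]_(s in oo p q) heat L t s = heat_int L t p q.
Proof.
move=> L0 /andP[p0 pq].
pose f s := expR (- L * (t - s)).
transitivity (\int[lebR]_(s in oo p q) (f \_ (oo 0 t)) s).
  apply: eq_Rintegral => s _; rewrite /heat /patch indicE.
  by case: ifP => _; rewrite ?mul1r ?mul0r.
rewrite -Rintegral_mkcondr /heat_int.
have -> : oo p q `&` oo 0 t = oo p (Num.min q t).
  apply/seteqP; split => s; rewrite /oo/= !in_itv/= lt_min.
    by move=> [/andP[-> ->] /andP[_ ->]].
  by move=> /and3P[ps -> ->]; rewrite ps (le_lt_trans p0 ps).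
have [tp|pt] := leP t p.
  rewrite !min_r ?(le_trans tp pq)// subrr mul0r.
  rewrite /oo set_itv_ge ?Rintegral_set0// bnd_simp -leNgt//.
have dF s : is_derive s (1 : R) (fun s => f s / L) (f s).
  rewrite /f.
  have d1 : is_derive (L * s) (1 : R) (fun s => expR (- L * t + s)) (expR (- L * t + L * s)).
    have d2 : is_derive (L * s) (1 : R) (+%R (- L * t)) 1.
      by apply: is_derive_eq; rewrite add0r.
    have := @is_derive1_comp R expR (+%R (- L * t)) (L * s) _ _ (is_derive_expR _) d2.
    by rewrite mulr1.
  have h := is_derive_scale d1.
  have -> : (fun s => expR (- L * (t - s)) / L) = L^-1 *: (fun s => expR (- L * t + L * s)).
    apply/funext => y; rewrite !fctE /GRing.scale/= mulrC; congr (_ * expR _); ring.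
  apply: is_derive_eq.
  rewrite /GRing.scale/= mulKf ?gt_eqF//; congr expR; ring.
rewrite (@Rintegral_FTC f (fun s => f s / L) _ _ _ _ dF).
- by rewrite /f mulrBl.
- by rewrite le_min pq ltW.
- exact: continuous_expR_affine.
Qed.

(** The eigenfunction [eigfun alpha] is the product of these normalized sines. *)
Definition sineb (k : nat) (y : R) : R := Num.sqrt 2 * sin (k%:R * pi * y).

Lemma sin_natpi n : sin (n%:R * pi) = 0 :> R.
Proof.
elim: n => [|n IH]; first by rewrite mul0r sin0.
by rewrite -natr1 mulrDl mul1r sinDpi IH oppr0.
Qed.

Lemma continuous_sineb k : continuous (sineb k).
Proof.
move=> x; apply: cvgM; first exact: cvg_cst.
apply: continuous_comp; last exact: continuous_sin.
by apply: cvgM; [exact: cvg_cst|exact: cvg_id].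
Qed.

Lemma sineb_norm k y : `|sineb k y| <= Num.sqrt 2.
Proof.
by rewrite normrM ger0_norm ?sqrtr_ge0// ler_piMr ?sqrtr_ge0// sin_max.
Qed.

Lemma continuous_cosM c : continuous (fun y : R => cos (c * y)).
Proof.
move=> x; apply: continuous_comp; last exact: continuous_cos.
by apply: cvgM; [exact: cvg_cst|exact: cvg_id].
Qed.

Lemma Rintegral_cosM c : c != 0 -> sin c = 0 ->
  \int[lebR]_(y in oo 0 1) cos (c * y) = 0.
Proof.
move=> c0 sc.
have dF x : is_derive x (1 : R) (fun y => c^-1 * sin (c * y)) (cos (c * x)).
  have h := @is_derive_scale sin (cos (c * x)) c x (is_derive_sin _).
  rewrite (_ : (fun y => _) = c^-1 *: (fun y => sin (c * y)))//.
  by apply: is_derive_eq; rewrite /GRing.scale/= mulKf.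
rewrite (Rintegral_FTC _ (@continuous_cosM c) dF)//.
by rewrite mulr1 sc mulr0 mulr0 sin0 mulr0 subrr.
Qed.

Lemma sineb_orthonormal k l : (0 < k)%N -> (0 < l)%N ->
  \int[lebR]_(y in oo 0 1) (sineb k y * sineb l y) = (k == l)%:R.
Proof.
move=> k0 l0.
have s2 : Num.sqrt 2 * Num.sqrt 2 = 2 :> R by rewrite -expr2 sqr_sqrtr.
have pi0 : pi != 0 :> R by rewrite gt_eqF// pi_gt0.
have e y : sineb k y * sineb l y =
    cos ((k%:R - l%:R) * pi * y) - cos ((k%:R + l%:R) * pi * y).
  rewrite /sineb !mulrBl !mulrDl cosB cosD mulrACA s2; ring.
under eq_Rintegral do rewrite e.
rewrite RintegralB//; try by apply: integrable_oo; exact: continuous_cosM.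
rewrite [X in _ - X]Rintegral_cosM; last 2 first.
- by rewrite -natrD mulf_neq0// pnatr_eq0 -lt0n addn_gt0 k0.
- by rewrite -natrD sin_natpi.
rewrite subr0; case: eqVneq => [->|kl].
  under eq_Rintegral do rewrite subrr !mul0r cos0.
  rewrite Rintegral_cst// mul1r.
  exact: (etrans (congr1 fine (lebesgue_measure_oo ler01)) (subr0 _)).
rewrite Rintegral_cosM//.
- by rewrite mulf_neq0// subr_eq0 eqr_nat.
- by rewrite mulrBl sinB !sin_natpi mul0r mulr0 subrr.
Qed.

End interval_integrals.

(** * Eigenfunctions and eigenvalues *)

Section eigenfunctions.
Context {R : realType} {d : nat}.
Local Notation mR := (measurableTypeR R).
Local Notation lebR := (@lebesgue_measure R).
Implicit Types alpha beta : 'I_d -> nat.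

Lemma cubeE : @cube R d = box (fun=> oo 0 1).
Proof. by apply/seteqP; split => x /= h i; move: (h i); rewrite /oo/= in_itv. Qed.

Lemma measurable_cube : measurable (@cube R d).
Proof. by rewrite cubeE; apply: measurable_box => i; exact: measurable_oo. Qed.

Lemma leb_cube : leb R d cube = 1%E.
Proof.
rewrite cubeE leb_box; last by move=> i; exact: measurable_oo.
by rewrite big1// => i _; rewrite lebesgue_measure_oo// subr0.
Qed.

Lemma leb_cube_lty : (leb R d cube < +oo)%E.
Proof. exact: (@eq_ind_r _ 1%E (fun z => (z < +oo)%E) (ltry _) _ leb_cube). Qed.

Lemma eigfunE alpha (x : Rn R d) : eigfun alpha x = \prod_(i < d) sineb (alpha i) (tnth x i).
Proof.
rewrite /eigfun /sineb big_split/= prodr_const card_ord; congr (_ * _).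
by rewrite mulrC powRrM powR12_sqrt// powR_mulrn ?sqrtr_ge0.
Qed.

Lemma measurable_eigfun alpha : measurable_fun setT (eigfun alpha : Rn R d -> R).
Proof.
rewrite (_ : eigfun alpha = fun x : Rn R d => \prod_(i < d) sineb (alpha i) (tnth x i)); last first.
  by apply/funext => x; exact: eigfunE.
have := @measurable_prod_tnth R d (fun i => sineb (alpha i)) (fun=> setT)
  (fun=> measurableT) (fun i => continuous_measurable_fun (@continuous_sineb R (alpha i))).
by rewrite (_ : box _ = setT)//; apply/seteqP; split.
Qed.

Lemma eigfun_norm alpha (x : Rn R d) : `|eigfun alpha x| <= Num.sqrt 2 ^+ d.
Proof.
rewrite eigfunE normr_prod -[in leRHS](card_ord d) -prodr_const.
by apply: ler_prod => i _; rewrite normr_ge0 sineb_norm.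
Qed.

Lemma eigfun_sqr_le alpha (x : Rn R d) : eigfun alpha x ^+ 2 <= 2 ^+ d.
Proof.
rewrite -real_normK ?num_real//.
have -> : 2 ^+ d = (Num.sqrt 2 ^+ d) ^+ 2 :> R.
  by rewrite -exprM mulnC exprM sqr_sqrtr.
by rewrite ler_sqr ?nnegrE ?exprn_ge0 ?sqrtr_ge0// eigfun_norm.
Qed.

Lemma integrable_cube_eigfunM alpha beta :
  (leb R d).-integrable cube (EFin \o (fun y => eigfun alpha y * eigfun beta y)).
Proof.
apply: (@bounded_integrable_EFin _ _ _ _ _ measurable_cube _ (Num.sqrt 2 ^+ d * Num.sqrt 2 ^+ d)).
- exact: leb_cube_lty.
- by apply: measurable_funTS; apply: measurable_funM; exact: measurable_eigfun.
- by move=> x _; rewrite normrM ler_pM// eigfun_norm.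
Qed.

Lemma eigfun_orthonormal alpha beta :
  positive_index alpha -> positive_index beta ->
  \int[leb R d]_(y in cube) (eigfun alpha y * eigfun beta y) =
  \prod_(i < d) (alpha i == beta i)%:R.
Proof.
move=> a0 b0.
rewrite cubeE (eq_bigr (fun i => \int[lebR]_(y in oo 0 1) (sineb (alpha i) y * sineb (beta i) y))); last first.
  by move=> i _; rewrite sineb_orthonormal.
have [_ <-] := @leb_box_integral R d
  (fun i y => sineb (alpha i) y * sineb (beta i) y) (fun=> oo 0 1)
  (fun=> @measurable_oo R 0 1) (fun i => integrable_oo 0 1
    (fun y => cvgM (@continuous_sineb R (alpha i) y) (@continuous_sineb R (beta i) y))).
by apply: eq_Rintegral => y _; rewrite !eigfunE -big_split.
Qed.

Lemma parseval K (c : ('I_d -> nat) -> R) :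
  \int[leb R d]_(y in cube) (boxsum (fun alpha => c alpha * eigfun alpha y) K) ^+ 2 =
  boxsum (fun alpha => c alpha ^+ 2) K.
Proof.
have e y : boxsum (fun alpha => c alpha * eigfun alpha y) K ^+ 2 =
    \sum_(a : {ffun 'I_d -> 'I_K}) \sum_(b : {ffun 'I_d -> 'I_K})
      c (multi a) * c (multi b) * (eigfun (multi a) y * eigfun (multi b) y).
  rewrite expr2 /boxsum mulr_suml; apply: eq_bigr => a _.
  by rewrite mulr_sumr; apply: eq_bigr => b _; rewrite mulrACA.
under eq_Rintegral do rewrite e.
rewrite Rintegral_bigsum; [|exact: measurable_cube|]; last first.
  move=> a; apply: (integrable_bigsum measurable_cube) => b.
  by apply: (integrableZ_EFin measurable_cube); exact: integrable_cube_eigfunM.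
apply: eq_bigr => a _.
rewrite Rintegral_bigsum; [|exact: measurable_cube|]; last first.
  move=> b.
  by apply: (integrableZ_EFin measurable_cube); exact: integrable_cube_eigfunM.
rewrite (bigD1 a)//= big1 ?addr0 => [|b ba].
  rewrite RintegralZl; [|exact: measurable_cube|exact: integrable_cube_eigfunM].
  rewrite eigfun_orthonormal ?big1 ?mulr1// ?expr2//; try exact: positive_multi.
  by move=> i _; rewrite eqxx.
rewrite RintegralZl; [|exact: measurable_cube|exact: integrable_cube_eigfunM].
rewrite eigfun_orthonormal; try exact: positive_multi.
suff [i ai] : exists i, a i != b i.
  have -> : \prod_(j < d) (multi a j == multi b j)%:R = 0 :> R.
    by rewrite (bigD1 i)//= /multi eqSS (negbTE ai : (a i == b i :> nat) = false) mul0r.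
  by rewrite mulr0.
apply/existsP; rewrite -negb_forall; apply: contra ba => /forallP ab.
by apply/eqP/ffunP => i; apply/esym/eqP.
Qed.

Lemma measurable_boxsum {dT} {T : measurableType dT} (D : set T) K
    (F : ('I_d -> nat) -> T -> R) :
  (forall alpha, measurable_fun D (F alpha)) ->
  measurable_fun D (fun z => boxsum (F ^~ z) K).
Proof. by move=> mF; apply: measurable_sum => a. Qed.

(** The decay rate in time of the mode [alpha], an eigenvalue of the squared
    Laplacian. *)
Definition rate alpha : R := lam R alpha ^+ 2.

Lemma rate_ge alpha i : (alpha i)%:R ^+ 4 <= rate alpha.
Proof.
rewrite /rate /lam /mnorm sqr_sqrtr; last by apply: sumr_ge0 => j _; rewrite exprn_ge0.
have h : (alpha i)%:R ^+ 2 <= pi ^+ 2 * \sum_(j < d) (alpha j)%:R ^+ 2 :> R.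
  have h1 : (alpha i)%:R ^+ 2 <= \sum_(j < d) (alpha j)%:R ^+ 2 :> R.
    rewrite (bigD1 i)//= lerDl; apply: sumr_ge0 => j _; exact: exprn_ge0.
  apply: (le_trans h1); rewrite ler_peMl//; first by apply: le_trans h1; exact: exprn_ge0.
  by rewrite exprn_ege1// (le_trans _ (pi_ge2 R))// ler1n.
have -> : (alpha i)%:R ^+ 4 = ((alpha i)%:R ^+ 2) ^+ 2 :> R by rewrite -exprM.
by rewrite ler_sqr ?nnegrE// ?exprn_ge0// (le_trans _ h)// exprn_ge0.
Qed.

Lemma rate_gt0 alpha : (0 < d)%N -> positive_index alpha -> 0 < rate alpha.
Proof.
move=> d0 a0; apply: lt_le_trans (rate_ge alpha (Ordinal d0)).
by rewrite exprn_gt0// ltr0n.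
Qed.

(** The rate is at least the fourth power of the largest entry, so by
    [boxsum_max_le] the sum is dominated by that of m^(d-1-4), which is finite
    as d < 4. *)
Lemma boxsum_inv_rate_le K : d = 2%N \/ d = 3%N ->
  boxsum (fun alpha => (rate alpha)^-1) K <= 2 * d%:R.
Proof.
move=> hd; have d0 : (0 < d)%N by case: hd => ->.
apply: (le_trans (@boxsum_max_le R d _ (fun m => (m%:R ^+ 4)^-1) K d0 _ _)).
- by move=> m; rewrite invr_ge0 exprn_ge0.
- move=> alpha i a0 _; rewrite lef_pV2 ?posrE ?rate_ge ?rate_gt0//.
  by rewrite exprn_gt0// ltr0n.
rewrite mulrC ler_wpM2r//.
apply: (@le_trans _ _ (\sum_(m < K) m.+1%:R `^ (- (1 + 1)))); last first.
  by apply: (le_trans (sum_powR_le _ _)); rewrite ?invr1//; lra.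
apply: ler_sum => m _.
have m0 : 0 < m.+1%:R :> R by [].
have m1 : 1 <= m.+1%:R :> R by rewrite ler1n.
rewrite powRN (_ : 1 + 1 = 2%:R) ?powR_mulrn//.
rewrite ler_pdivrMr ?exprn_gt0//.
have -> : (m.+1%:R ^+ 2)^-1 * m.+1%:R ^+ 4 = m.+1%:R ^+ 2 :> R.
  by rewrite -[4%N]/(2 + 2)%N exprD mulKf// expf_neq0// gt_eqF.
by rewrite ler_weXn2l//; case: hd => ->.
Qed.

End eigenfunctions.

(** * Bounds for the exponentials in time *)

Section heat_bounds.
Context {R : realType}.
Implicit Types L t p q : R.

Lemma expR_decay_mono L t p q : 0 <= L -> p <= q ->
  expR (- L * (t - Num.min p t)) <= expR (- L * (t - Num.min q t)).
Proof.
move=> L0 pq; rewrite ler_expR !mulNr lerN2 ler_wpM2l// lerD2l lerN2.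
by rewrite le_min !ge_min pq lexx !orbT.
Qed.

Lemma expR_decay_le1 L t p : 0 <= L -> expR (- L * (t - Num.min p t)) <= 1.
Proof.
move=> L0; rewrite -expR0 ler_expR mulNr oppr_le0 mulr_ge0// subr_ge0.
by rewrite ge_min lexx orbT.
Qed.

Lemma heat_int_ge0 L t p q : 0 < L -> p <= q -> 0 <= heat_int L t p q.
Proof.
move=> L0 pq; rewrite /heat_int divr_ge0 ?(ltW L0)// subr_ge0.
by rewrite expR_decay_mono ?(ltW L0).
Qed.

Lemma heat_int_le_inv L t p q : 0 < L -> heat_int L t p q <= L^-1.
Proof.
move=> L0; rewrite /heat_int ler_piMl ?invr_ge0 ?(ltW L0)//.
have := expR_decay_le1 t q (ltW L0); have := expR_ge0 (- L * (t - Num.min p t)).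
lra.
Qed.

(** Compares the kernel at a fixed positive time with the summable inverses of
    the rates. *)
Lemma expR_decay_le_inv L r : 0 < L -> 0 < r -> expR (- L * r) <= L^-1 * r^-1.
Proof.
move=> L0 r0; rewrite mulNr expRN -invfM lef_pV2 ?posrE ?expR_gt0 ?mulr_gt0//.
by have := expR_ge1Dx (L * r); lra.
Qed.

End heat_bounds.

(** * Spectral expansion of the mild integrand *)

Section green_expansion.
Context {R : realType} {d : nat} (hd : d = 2%N \/ d = 3%N).
Local Notation mR := (measurableTypeR R).
Local Notation lebR := (@lebesgue_measure R).
Implicit Types (alpha beta : 'I_d -> nat) (t T : R) (K : nat).

Let d_gt0 : (0 < d)%N. Proof. by case: hd => ->. Qed.

Let rate_pos alpha : positive_index alpha -> 0 < rate (R := R) alpha.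
Proof. exact: rate_gt0. Qed.

Definition mild_coef t alpha (z : mR * Rn R d) : R :=
  heat (rate alpha) t z.1 * eigfun alpha z.2.

Definition mild_trunc t (x : Rn R d) K z : R :=
  boxsum (fun alpha => eigfun alpha x * mild_coef t alpha z) K.

Definition heat_trace_trunc t K s : R :=
  boxsum (fun alpha => 2 ^+ d * heat (rate alpha) t s) K.

(** An integrable majorant of all truncations of the mild integrand.  It is
    not square integrable in time for d >= 2, as it has the order
    (t - s)^(-d/4) near t; it controls the integrals of the integrand over cells,
    whereas its square is integrated by Parseval. *)
Definition heat_trace t s : R := limn (heat_trace_trunc t ^~ s).

Lemma heat_le_inv L t s : 0 < L -> heat L t s <= L^-1 * `|t - s|^-1.
Proof.
move=> L0; rewrite /heat indicE; case: (boolP (s \in _)) => [/set_mem|_].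
  rewrite /oo/= in_itv/= => /andP[s0 st]; rewrite mul1r gtr0_norm ?subr_gt0//.
  by rewrite expR_decay_le_inv// subr_gt0.
by rewrite mul0r mulr_ge0 ?invr_ge0 ?(ltW L0).
Qed.

Let heat_trace_bound t s K :
  boxsum (fun alpha => 2 ^+ d * ((rate alpha)^-1 * `|t - s|^-1)) K <=
  2 ^+ d * (`|t - s|^-1 * (2 * d%:R)).
Proof.
rewrite boxsumZ ler_wpM2l ?exprn_ge0//.
under [X in boxsum X]eq_fun do rewrite mulrC.
by rewrite boxsumZ ler_wpM2l ?invr_ge0// boxsum_inv_rate_le.
Qed.

Let norm_heat_trace_term t s alpha : positive_index alpha ->
  `|2 ^+ d * heat (rate alpha) t s| <= 2 ^+ d * ((rate alpha)^-1 * `|t - s|^-1).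
Proof.
move=> a0; rewrite ger0_norm ?mulr_ge0 ?exprn_ge0 ?heat_ge0//.
by rewrite ler_wpM2l ?exprn_ge0// heat_le_inv// rate_pos.
Qed.

Lemma is_cvg_heat_trace t s : cvgn (heat_trace_trunc t ^~ s).
Proof. exact: (is_cvg_boxsum (@norm_heat_trace_term t s) (@heat_trace_bound t s)). Qed.

Lemma heat_trace_trunc_nondecreasing t s : nondecreasing_seq (heat_trace_trunc t ^~ s).
Proof.
by apply: boxsum_nondecreasing => alpha _; rewrite mulr_ge0 ?exprn_ge0 ?heat_ge0.
Qed.

Lemma heat_trace_trunc_le t s K : heat_trace_trunc t K s <= heat_trace t s.
Proof.
apply: nondecreasing_cvgn_le; first exact: heat_trace_trunc_nondecreasing.
exact: is_cvg_heat_trace.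
Qed.

Lemma heat_trace_trunc_ge0 t s K : 0 <= heat_trace_trunc t K s.
Proof. by apply: sumr_ge0 => a _; rewrite mulr_ge0 ?exprn_ge0 ?heat_ge0. Qed.

Lemma heat_trace_ge0 t s : 0 <= heat_trace t s.
Proof. exact: le_trans (heat_trace_trunc_ge0 t s 0) (heat_trace_trunc_le t s 0). Qed.

Lemma measurable_heat_trace_trunc t K :
  measurable_fun setT (heat_trace_trunc t K : mR -> R).
Proof.
apply: measurable_boxsum => alpha; apply: measurable_funM => //.
exact: measurable_heat.
Qed.

Lemma measurable_heat_trace t : measurable_fun setT (heat_trace t : mR -> R).
Proof.
apply: (@measurable_fun_cvg _ _ _ _ (heat_trace_trunc t)).
  by move=> K; exact: measurable_heat_trace_trunc.
by move=> s _; exact: is_cvg_heat_trace.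
Qed.

(** Each mode contributes at most the inverse of its rate, and these are
    summable. *)
Lemma integrable_heat_trace t T : 0 <= T ->
  lebR.-integrable (oo 0 T) (EFin \o heat_trace t).
Proof.
move=> T0; apply/integrableP; split.
  apply/measurable_EFinP; apply: measurable_funTS; exact: measurable_heat_trace.
under eq_integral do rewrite /= ger0_norm ?heat_trace_ge0//.
have mT : measurable (oo 0 T) by exact: measurable_oo.
rewrite (eq_integral (fun s : mR => limn (fun K => (heat_trace_trunc t K s)%:E))); last first.
  move=> s _; rewrite -(@EFin_lim _ (heat_trace_trunc t ^~ s))//.
  exact: is_cvg_heat_trace.
rewrite (monotone_convergence lebR mT); last 3 first.
- by move=> K; apply/measurable_EFinP; apply: measurable_funTS; exact: measurable_heat_trace_trunc.
- by move=> K s _; rewrite lee_fin heat_trace_trunc_ge0.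
- by move=> s _ m n mn; rewrite lee_fin; exact: heat_trace_trunc_nondecreasing.
apply: (@le_lt_trans _ _ (2 ^+ d * (2 * d%:R))%:E); last exact: ltry.
have intE K : (\int[lebR]_(s in oo 0 T) (heat_trace_trunc t K s)%:E =
    (boxsum (fun alpha => 2 ^+ d * heat_int (rate alpha) t 0 T) K)%:E)%E.
  have ih (a : {ffun 'I_d -> 'I_K}) : lebR.-integrable (oo 0 T)
      (EFin \o (fun s => 2 ^+ d * heat (rate (multi a)) t s)).
    apply: (integrableZ_EFin mT); apply: integrable_heat.
    by apply: ltW; exact: rate_pos.
  rewrite EFin_Rintegral//; last exact: (integrable_bigsum mT).
  rewrite (Rintegral_bigsum mT)//; congr EFin; apply: eq_bigr => a _.
  rewrite RintegralZl//; last first.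
    by apply: integrable_heat; apply: ltW; exact: rate_pos.
  by rewrite Rintegral_heat ?lexx//; exact: rate_pos.
under eq_fun do rewrite intE.
apply: lime_le.
  apply: ereal_nondecreasing_is_cvgn => m n mn; rewrite lee_fin.
  apply: boxsum_nondecreasing => // alpha a0.
  by rewrite mulr_ge0 ?exprn_ge0// heat_int_ge0// rate_pos.
apply: nearW => K; rewrite lee_fin boxsumZ ler_wpM2l ?exprn_ge0//.
apply: le_trans (boxsum_inv_rate_le K hd); apply: ler_boxsum => a.
by apply: heat_int_le_inv; exact: rate_pos.
Qed.

Let norm_mild_term t (x : Rn R d) z alpha :
  `|eigfun alpha x * mild_coef t alpha z| <= 2 ^+ d * heat (rate alpha) t z.1.
Proof.
rewrite mulrCA normrM ger0_norm ?heat_ge0// mulrC ler_wpM2r ?heat_ge0//.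
have -> : 2 ^+ d = Num.sqrt 2 ^+ d * Num.sqrt 2 ^+ d :> R.
  by rewrite -exprMn -expr2 sqr_sqrtr.
by rewrite normrM ler_pM ?eigfun_norm.
Qed.

Lemma norm_mild_trunc_le t x K z : `|mild_trunc t x K z| <= heat_trace t z.1.
Proof.
apply: le_trans (heat_trace_trunc_le t z.1 K).
by apply: ler_norm_boxsum => alpha _; exact: norm_mild_term.
Qed.

Lemma mild_trunc_cvg t x z : mild_trunc t x K z @[K --> \oo] --> mild_integrand t x z.
Proof.
have c : cvgn (fun K => mild_trunc t x K z).
  apply: (@is_cvg_boxsum R d _ _ (2 ^+ d * (`|t - z.1|^-1 * (2 * d%:R)))).
    move=> alpha a0; apply: le_trans (norm_mild_term _ _ _ _) _.
    exact: le_trans (ler_norm _) (norm_heat_trace_term _ _ a0).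
  by move=> K; exact: heat_trace_bound.
suff -> : mild_integrand t x z = limn (fun K => mild_trunc t x K z) by [].
rewrite /mild_integrand indicE /green.
case: (boolP (z.1 \in _)) => zt; last first.
  rewrite mul0r; apply/esym/cvg_lim => //.
  rewrite (_ : (fun _ => _) = cst 0); first exact: cvg_cst.
  apply/funext => K; rewrite /mild_trunc /boxsum big1// => a _.
  by rewrite /mild_coef /heat indicE (negbTE zt) !mul0r mulr0.
rewrite mul1r; congr (limn _); apply/funext => K; apply: eq_bigr => a _.
rewrite /green_term /mild_coef /heat indicE zt mul1r /rate.
by rewrite mulrA [in RHS](mulrC (eigfun _ x)).
Qed.

Lemma measurable_mild_coef t alpha : measurable_fun setT (mild_coef t alpha).
Proof.
apply: measurable_funM.
  apply: (@measurableT_comp _ _ _ _ _ _ (heat (rate alpha) t) _ fst) => //.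
  exact: measurable_heat.
apply: (@measurableT_comp _ _ _ _ _ _ (eigfun alpha) _ snd) => //.
exact: measurable_eigfun.
Qed.

Lemma measurable_mild_trunc t x K : measurable_fun setT (mild_trunc t x K).
Proof.
apply: measurable_boxsum => alpha; apply: measurable_funM => //.
exact: measurable_mild_coef.
Qed.

Lemma measurable_mild_integrand t x : measurable_fun setT (@mild_integrand R d t x).
Proof.
apply: (@measurable_fun_cvg _ _ _ _ (mild_trunc t x)).
  by move=> K; exact: measurable_mild_trunc.
by move=> z _; exact: mild_trunc_cvg.
Qed.

Lemma cylinderE T : @cylinder R d T = oo 0 T `*` cube.
Proof. by []. Qed.

Lemma measurable_cylinder T : measurable (@cylinder R d T).
Proof. by apply: measurableX; [exact: measurable_oo|exact: measurable_cube]. Qed.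

Lemma integrable_cylinder_heat_trace t T : 0 <= T ->
  (@spacetime R d).-integrable (cylinder T) (EFin \o (fun z => heat_trace t z.1)).
Proof.
move=> T0.
have h1 : (leb R d).-integrable cube (EFin \o cst 1).
  apply: (@bounded_integrable_EFin _ _ _ _ _ measurable_cube (cst 1) 1) => //.
    exact: leb_cube_lty.
  by move=> y _; rewrite normr1.
have := integrable_setX (measurable_oo 0 T) measurable_cube (integrable_heat_trace t T0) h1.
rewrite cylinderE; apply: eq_integrable; first exact: measurable_cylinder.
by move=> z _; rewrite /= mulr1.
Qed.

Lemma integrable_mild_integrand t x T : 0 <= T ->
  (@spacetime R d).-integrable (cylinder T) (EFin \o mild_integrand t x).
Proof.
move=> T0.
have [] := @dominated_cvg_Rintegral _ _ _ (@spacetime R d) (cylinder T)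
  (measurable_cylinder T) (mild_trunc t x) (mild_integrand t x) (fun z => heat_trace t z.1).
- by move=> K; apply: measurable_funTS; exact: measurable_mild_trunc.
- by move=> z _; exact: mild_trunc_cvg.
- exact: integrable_cylinder_heat_trace.
- by move=> K z _; exact: norm_mild_trunc_le.
by [].
Qed.

Definition st_box p q (a b : 'I_d -> R) : set (mR * Rn R d) :=
  oo p q `*` box (fun i => oo (a i) (b i)).

Lemma measurable_st_box p q a b : measurable (st_box p q a b).
Proof.
apply: measurableX; first exact: measurable_oo.
by apply: measurable_box => i; exact: measurable_oo.
Qed.

Lemma Rintegral_st_box_mild_coef t alpha p q (a b : 'I_d -> R) : positive_index alpha ->
  0 <= p <= q ->
  (@spacetime R d).-integrable (st_box p q a b) (EFin \o mild_coef t alpha) /\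
  \int[spacetime]_(z in st_box p q a b) mild_coef t alpha z =
  heat_int (rate alpha) t p q *
  \prod_i \int[lebR]_(y in oo (a i) (b i)) sineb (alpha i) y.
Proof.
move=> a0 pq.
have mb i : measurable (oo (a i) (b i)) by exact: measurable_oo.
have [] := @leb_box_integral R d (fun i => sineb (alpha i))
  (fun i => oo (a i) (b i)) mb (fun i => integrable_oo (a i) (b i) (@continuous_sineb R (alpha i))).
have -> : (fun x : Rn R d => \prod_(i < d) sineb (alpha i) (tnth x i)) = eigfun alpha.
  by apply/funext => y; rewrite eigfunE.
move=> inte <-.
have inth : lebR.-integrable (oo p q) (EFin \o heat (rate alpha) t).
  by apply: integrable_heat; apply: ltW; exact: rate_pos.
have mB : measurable (box (fun i => oo (a i) (b i))) by exact: measurable_box.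
have mpq : measurable (oo p q) by exact: measurable_oo.
split; first exact: (integrable_setX mpq mB inth inte).
rewrite -(Rintegral_heat _ (rate_pos a0) pq).
exact: (Rintegral_setX mpq mB inth inte).
Qed.

(** Dominated convergence with [heat_trace] allows the integration of the
    expansion mode by mode. *)
Lemma Rintegral_st_box_mild t x p q (a b : 'I_d -> R) T :
  0 <= p <= q -> q <= T -> (forall i, 0 <= a i) -> (forall i, b i <= 1) ->
  boxsum (fun alpha => eigfun alpha x * (heat_int (rate alpha) t p q *
    \prod_i \int[lebR]_(y in oo (a i) (b i)) sineb (alpha i) y)) K @[K --> \oo] -->
  \int[spacetime]_(z in st_box p q a b) mild_integrand t x z.
Proof.
move=> pq qT a0 b1.
have T0 : 0 <= T by case/andP: pq => p0 pq; rewrite (le_trans p0)// (le_trans pq).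
have sub : st_box p q a b `<=` cylinder T.
  move=> [s y] [/=]; rewrite /oo/= in_itv/= => /andP[ps sq] h; split => /=.
    rewrite in_itv/= (lt_le_trans sq qT) andbT.
    by case/andP: pq => p0 _; rewrite (le_lt_trans p0).
  move=> i; have := h i; rewrite /oo/= in_itv/= => /andP[ay yb].
  by rewrite (le_lt_trans (a0 i) ay) (lt_le_trans yb (b1 i)).
have [_] := @dominated_cvg_Rintegral _ _ _ (@spacetime R d) (st_box p q a b)
  (measurable_st_box p q a b) (mild_trunc t x) (mild_integrand t x) (fun z => heat_trace t z.1)
  (fun K => measurable_funTS (@measurable_mild_trunc t x K))
  (fun z _ => @mild_trunc_cvg t x z)
  (integrableS (measurable_cylinder T) (measurable_st_box p q a b) sub
    (integrable_cylinder_heat_trace t T0))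
  (fun K z _ => @norm_mild_trunc_le t x K z).
rewrite (_ : (fun K => _) = (fun K => boxsum (fun alpha => eigfun alpha x *
  (heat_int (rate alpha) t p q *
    \prod_i \int[lebR]_(y in oo (a i) (b i)) sineb (alpha i) y)) K))//.
apply/funext => K; have mS := measurable_st_box p q a b.
have h (al : {ffun 'I_d -> 'I_K}) :=
  @Rintegral_st_box_mild_coef t (multi al) p q a b (@positive_multi _ _ al) pq.
rewrite (Rintegral_bigsum mS); last first.
  by move=> al; apply: (integrableZ_EFin mS); have [] := h al.
by apply: eq_bigr => al _; have [h1 h2] := h al; rewrite RintegralZl// h2.
Qed.

Definition energy_term t T (x : Rn R d) alpha : R :=
  eigfun alpha x ^+ 2 * heat_int (2 * rate alpha) t 0 T.

(** At a fixed time the truncations are bounded by the constant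
    [heat_trace t s], so dominated convergence applies to their squares on the
    cube and Parseval evaluates the integrals. *)
Lemma integral_mild_sqr_slice t x s :
  (\int[leb R d]_(y in cube) (mild_integrand t x (s, y) ^+ 2)%:E =
   limn (fun K => (boxsum (fun alpha => eigfun alpha x ^+ 2 * heat (2 * rate alpha) t s) K)%:E))%E.
Proof.
have mc := @measurable_cube R d.
have mpair : measurable_fun setT (fun y : Rn R d => (s : mR, y)) by exact: measurable_pair1.
have hc y : mild_trunc t x K (s, y) ^+ 2 @[K --> \oo] --> mild_integrand t x (s, y) ^+ 2.
  exact: (cvgM (@mild_trunc_cvg t x (s, y)) (@mild_trunc_cvg t x (s, y))).
have h0 y K : `|mild_trunc t x K (s, y) ^+ 2| <= heat_trace t s ^+ 2.
  rewrite normrX ler_sqr ?nnegrE ?heat_trace_ge0//.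
  exact: (norm_mild_trunc_le t x K (s, y)).
have ib : (leb R d).-integrable cube (EFin \o cst (heat_trace t s ^+ 2)).
  apply: (@bounded_integrable_EFin _ _ _ _ _ mc _ `|heat_trace t s ^+ 2|) => //.
  exact: leb_cube_lty.
have [intf cvgf] := @dominated_cvg_Rintegral _ _ _ (leb R d) cube mc
  (fun K y => mild_trunc t x K (s, y) ^+ 2) (fun y => mild_integrand t x (s, y) ^+ 2)
  (cst (heat_trace t s ^+ 2))
  (fun K => measurable_funTS (measurable_funX 2 (measurableT_comp (@measurable_mild_trunc t x K) mpair)))
  (fun y _ => hc y)
  ib
  (fun K y _ => h0 y K).
rewrite (EFin_Rintegral mc intf) -(cvg_lim _ cvgf)// -EFin_lim; last first.
  by apply/cvg_ex; eexists; exact: cvgf.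
congr (limn _); apply/funext => K /=; congr EFin.
under eq_Rintegral do rewrite /mild_trunc /mild_coef /=.
transitivity (\int[leb R d]_(y in cube)
  (boxsum (fun alpha => (eigfun alpha x * heat (rate alpha) t s) * eigfun alpha y) K) ^+ 2).
  by apply: eq_Rintegral => y _; congr (boxsum _ K ^+ 2); apply/funext => alpha; rewrite mulrA.
rewrite parseval; congr (boxsum _ K); apply/funext => alpha.
by rewrite exprMn heat_sqr.
Qed.

Lemma energy_term_bounds t T x alpha : 0 <= T -> positive_index alpha ->
  0 <= energy_term t T x alpha <= 2 ^+ d * (rate alpha)^-1.
Proof.
move=> T0 a0; have r0 := rate_pos a0.
have r20 : 0 < 2 * rate alpha :> R by rewrite mulr_gt0.
rewrite /energy_term mulr_ge0 ?exprn_even_ge0 ?heat_int_ge0//=.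
apply: ler_pM; rewrite ?exprn_even_ge0 ?heat_int_ge0 ?eigfun_sqr_le//.
apply: (le_trans (heat_int_le_inv _ _ _ r20)).
by rewrite lef_pV2 ?posrE// ler_peMl ?(ltW r0)// ler1n.
Qed.

Lemma is_cvg_energy t T x : 0 <= T -> cvgn (boxsum (energy_term t T x)).
Proof.
move=> T0; apply: (@is_cvg_boxsum R d _ (fun alpha => 2 ^+ d * (rate alpha)^-1) (2 ^+ d * (2 * d%:R))).
  move=> alpha a0; have /andP[e0 e1] := energy_term_bounds t x T0 a0.
  by rewrite ger0_norm.
by move=> K; rewrite boxsumZ ler_wpM2l ?exprn_ge0// boxsum_inv_rate_le.
Qed.

(** Integrates the slices in time by monotone convergence: after Parseval all
    terms are nonnegative. *)
Lemma integral_mild_sqr t x T : 0 <= T ->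
  (\int[spacetime]_(z in cylinder T) (mild_integrand t x z ^+ 2)%:E =
   (limn (boxsum (energy_term t T x)))%:E)%E.
Proof.
move=> T0; have mT : measurable (oo 0 T) by exact: measurable_oo.
rewrite fubini_tonelli_setX1; [|exact: mT|exact: measurable_cube|..]; last 2 first.
- apply/measurable_EFinP; apply: measurable_funTS; apply: measurable_funX.
  exact: measurable_mild_integrand.
- by move=> z _; rewrite lee_fin exprn_even_ge0.
under eq_integral do rewrite integral_mild_sqr_slice.
pose e K s := boxsum (fun alpha => eigfun alpha x ^+ 2 * heat (2 * rate alpha) t s) K.
have rate2 alpha : positive_index alpha -> 0 < 2 * rate (R := R) alpha.
  by move=> a0; rewrite mulr_gt0// rate_pos.
rewrite (monotone_convergence lebR mT); last 3 first.
- move=> K; apply/measurable_EFinP; apply: measurable_funTS; apply: measurable_boxsum => alpha.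
  by apply: measurable_funM => //; exact: measurable_heat.
- move=> K s _; rewrite lee_fin; apply: sumr_ge0 => a _.
  by rewrite mulr_ge0 ?heat_ge0 ?exprn_even_ge0.
- move=> s _ m n mn; rewrite lee_fin; apply: boxsum_nondecreasing => // alpha _.
  by rewrite mulr_ge0 ?heat_ge0 ?exprn_even_ge0.
rewrite -EFin_lim; last exact: is_cvg_energy.
congr (limn _); apply/funext => K.
have ih (a : {ffun 'I_d -> 'I_K}) : lebR.-integrable (oo 0 T) (EFin \o heat (2 * rate (multi a)) t).
  by apply: integrable_heat; apply: ltW; exact: rate2.
rewrite (EFin_Rintegral mT); last first.
  by apply: (integrable_bigsum mT) => a; exact: (integrableZ_EFin mT).
rewrite (Rintegral_bigsum mT); last by move=> a; exact: (integrableZ_EFin mT).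
congr EFin; apply: eq_bigr => a _.
by rewrite RintegralZl// Rintegral_heat ?lexx//; exact: rate2.
Qed.

End green_expansion.

(** * Square-integrable functions and averages over cells *)

Section square_integrable.
Context {dT : measure_display} {T : measurableType dT} {R : realType}.
Context (mu : {measure set T -> \bar R}) (D : set T) (mD : measurable D).
Implicit Types f g : T -> R.

Lemma sqr_poweR_half (x : \bar R) : (0 <= x)%E -> ((x `^ 2^-1) ^+ 2 = x)%E.
Proof.
case: x => [r| |]//.
- by rewrite lee_fin => r0; rewrite poweR_EFin powR12_sqrt// -EFin_expe sqr_sqrtr.
- by move=> _; rewrite poweRyr.
Qed.

Lemma sqr_L2norm f : (L2norm mu D f ^+ 2 = \int[mu]_(x in D) (f x ^+ 2)%:E)%E.
Proof.
rewrite /L2norm sqr_poweR_half; last first.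
  by apply: integral_ge0 => x _; rewrite lee_fin exprn_ge0.
by apply: eq_integral => x _; rewrite real_normK// num_real.
Qed.

Lemma in_L2P f : in_L2 mu D f <->
  measurable_fun D f /\ mu.-integrable D (EFin \o (fun x => f x ^+ 2)).
Proof.
have e : (\int[mu]_(x in D) `|(f x ^+ 2)%:E| = L2norm mu D f ^+ 2)%E.
  by rewrite sqr_L2norm; apply: eq_integral => x _; rewrite /= ger0_norm// exprn_even_ge0.
split=> -[mf foo]; split => //.
  apply/integrableP; split; first by apply/measurable_EFinP; exact: measurable_funX.
  rewrite /= e.
  have n0 : (0 <= L2norm mu D f)%E by exact: poweR_ge0.
  by rewrite -(@fineK _ (L2norm mu D f)) ?ge0_fin_numE// -EFin_expe ltry.
move: foo => /integrableP[_] /=; rewrite e.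
have n0 : (0 <= L2norm mu D f)%E by exact: poweR_ge0.
by case: (L2norm mu D f) n0 => [r _ _|_|]//; exact: ltry.
Qed.

Lemma sqr_fine_L2norm f : in_L2 mu D f ->
  fine (L2norm mu D f) ^+ 2 = \int[mu]_(x in D) (f x ^+ 2).
Proof.
move=> [mf foo]; rewrite /Rintegral -sqr_L2norm.
have n0 : (0 <= L2norm mu D f)%E by exact: poweR_ge0.
by rewrite -(@fineK _ (L2norm mu D f)) ?ge0_fin_numE.
Qed.

Lemma in_L2_lin (a : R) f g : in_L2 mu D f -> in_L2 mu D g ->
  in_L2 mu D (fun x => a * f x + g x).
Proof.
move=> /in_L2P[mf f2] /in_L2P[mg g2]; apply/in_L2P.
have maf : measurable_fun D (fun x => a * f x + g x).
  by apply: measurable_funD => //; exact: measurable_funM.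
split => //; apply: (le_integrable_EFin mD (g := fun x => (2 * a ^+ 2) * f x ^+ 2 + 2 * g x ^+ 2)).
- exact: measurable_funX.
- move=> x _; rewrite ger0_norm ?exprn_even_ge0//.
  have := sqr_ge0 (a * f x - g x); lra.
- by apply: (integrableD_EFin mD); exact: (integrableZ_EFin mD).
Qed.

Lemma in_L2_scale (a : R) f : in_L2 mu D f -> in_L2 mu D (fun x => a * f x).
Proof.
move=> /in_L2P[mf f2]; apply/in_L2P; split; first exact: measurable_funM.
rewrite (_ : (fun x => (a * f x) ^+ 2) = (fun x => a ^+ 2 * f x ^+ 2)).
  exact: (integrableZ_EFin mD).
by apply/funext => x; rewrite exprMn.
Qed.

Lemma in_L2_bounded f (M : R) : (mu D < +oo)%E -> measurable_fun D f ->
  (forall x, D x -> `|f x| <= M) -> in_L2 mu D f.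
Proof.
move=> Doo mf fM; apply/in_L2P; split => //.
apply: (@bounded_integrable_EFin _ _ _ _ _ mD _ (M ^+ 2)) => //.
  exact: measurable_funX.
move=> x Dx; rewrite normrX ler_sqr ?nnegrE ?fM//.
by rewrite (le_trans _ (fM x Dx)).
Qed.

(** Pythagoras for the averaging over cells.  At each point at most one of the
    indicators is nonzero, so the square of the difference expands pointwise
    into the square of [g] and terms linear in [g], one per cell. *)
Lemma Rintegral_sqr_sub_averages (I : finType) (S : I -> set T) (v : R) g :
  0 < v -> (forall i, measurable (S i)) -> (forall i, S i `<=` D) ->
  (forall i, fine (mu (S i)) = v) -> (forall i, (mu (S i) < +oo)%E) ->
  (forall i j z, S i z -> S j z -> i = j) ->
  mu.-integrable D (EFin \o g) -> mu.-integrable D (EFin \o (fun x => g x ^+ 2)) ->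
  \int[mu]_(x in D) (g x - \sum_i v^-1 * (\int[mu]_(y in S i) g y) * \1_(S i) x) ^+ 2 =
  \int[mu]_(x in D) (g x ^+ 2) - v^-1 * \sum_i (\int[mu]_(y in S i) g y) ^+ 2.
Proof.
move=> v0 mS SD Sv Soo Sdisj ig ig2.
pose c i := v^-1 * \int[mu]_(y in S i) g y.
pose h i x : R := 2 * c i * (g \_ (S i)) x - c i ^+ 2 * \1_(S i) x.
have pE x : (g x - \sum_i c i * \1_(S i) x) ^+ 2 = g x ^+ 2 - \sum_i h i x.
  have [[i Six]|nS] := pselect (exists i, S i x).
    have oth j : j != i -> \1_(S j) x = 0 :> R.
      move=> ji; rewrite indicE memNset// => Sjx.
      by move/eqP: ji; apply; exact: Sdisj Sjx Six.
    rewrite (bigD1 i)//= big1 => [|j ji]; last by rewrite oth ?mulr0.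
    rewrite (bigD1 i)//= big1 => [|j ji].
      by rewrite /h /patch !indicE !mem_set//=; ring.
    rewrite /h oth// /patch ifF ?mulr0 ?subrr//; apply/negP => /set_mem Sjx.
    by move/eqP: ji; apply; exact: Sdisj Sjx Six.
  rewrite !big1 ?subr0// => j _.
    by rewrite /h /patch indicE memNset ?mulr0 ?subrr// => Sjx; apply: nS; exists j.
  by rewrite indicE memNset ?mulr0// => Sjx; apply: nS; exists j.
under eq_Rintegral do rewrite pE.
have igS i : mu.-integrable D (EFin \o g \_ (S i)).
  exact: (integrable_patch mD).
have i1 i : mu.-integrable D (EFin \o (\1_(S i) : T -> R)).
  apply/integrableP; split; first by apply/measurable_EFinP; exact: measurable_indic.
  by under eq_integral do rewrite /= ger0_norm//; rewrite integral_indic// setIidl.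
have ih i : mu.-integrable D (EFin \o h i).
  by apply: (integrableB_EFin mD); exact: (integrableZ_EFin mD).
rewrite RintegralB//; last exact: (integrable_bigsum mD).
rewrite (Rintegral_bigsum mD)//; congr (_ - _).
rewrite mulr_sumr; apply: eq_bigr => i _.
rewrite /h RintegralB//; try exact: (integrableZ_EFin mD).
rewrite !RintegralZl// -Rintegral_mkcondr setIidr//.
have -> : \int[mu]_(x in D) (\1_(S i) x : R) = v.
  by rewrite /Rintegral integral_indic// setIidl.
by rewrite /c; field; rewrite gt_eqF.
Qed.

End square_integrable.

(** * Second moment of the standard Gaussian law *)

Section gaussian_second_moment.
Context {R : realType}.
Local Notation mR := (measurableTypeR R).
Local Notation lebR := (@lebesgue_measure R).

(** The density is the Radon-Nikodym derivative, by uniqueness of the latter. *)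
Lemma ge0_integral_normal_prob (m s : R) (f : mR -> \bar R) :
  measurable_fun setT f -> (forall x, 0 <= f x)%E ->
  (\int[normal_prob m s]_x f x = \int[lebR]_x (f x * (normal_pdf m s x)%:E))%E.
Proof.
move=> mf f0; have dom := normal_prob_dominates m s.
rewrite -(Radon_Nikodym_SigmaFinite.change_of_variables dom)//.
have ir := Radon_Nikodym_SigmaFinite.f_integrable dom.
have mp : measurable_fun setT (EFin \o normal_pdf m s).
  by apply/measurable_EFinP; exact: measurable_normal_pdf.
apply: ae_eq_integral => //.
- by apply: emeasurable_funM => //; exact: measurable_int ir.
- exact: emeasurable_funM.
- apply: ae_eqe_mul2l; apply: integral_ae_eq => // E _ mE.
  by rewrite -Radon_Nikodym_SigmaFinite.f_integral.
Qed.

(** Scaling reduces the second moment of every centered Gaussian law to this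
    one, which enters the final constant as a factor. *)
Definition gaussian_moment2 : \bar R :=
  (\int[normal_prob 0 1]_x ((x : R) ^+ 2)%:E)%E.

Lemma gaussian_moment2_ge0 : (0 <= gaussian_moment2)%E.
Proof. by apply: integral_ge0 => x _; rewrite lee_fin exprn_even_ge0. Qed.

(** Domination of x^2 exp(- x^2 / 2) by 4 exp(- x^2 / 8), a multiple of the
    density of standard deviation 2. *)
Lemma gaussian_moment2_fin : gaussian_moment2 \is a fin_num.
Proof.
rewrite ge0_fin_numE ?gaussian_moment2_ge0// /gaussian_moment2.
rewrite ge0_integral_normal_prob; last 2 first.
- by apply/measurable_EFinP; exact: measurable_funX.
- by move=> x; rewrite lee_fin exprn_even_ge0.
pose k : R := 4 * normal_peak 1 / normal_peak 2.
have p2 : 0 < normal_peak 2 :> R by apply: normal_peak_gt0.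
have k0 : 0 <= k by rewrite /k divr_ge0 ?mulr_ge0 ?normal_peak_ge0.
apply: (@le_lt_trans _ _ (\int[lebR]_x (k%:E * (normal_pdf 0 2 x)%:E))%E); last first.
  rewrite ge0_integralZl//.
  - by rewrite integral_normal_pdf mule1 ltry.
  - by apply/measurable_EFinP; exact: measurable_normal_pdf.
  - by move=> x _; rewrite lee_fin normal_pdf_ge0.
apply: ge0_le_integral => //.
- by move=> x _; rewrite -EFinM lee_fin mulr_ge0 ?normal_pdf_ge0 ?exprn_even_ge0.
- apply: emeasurable_funM.
    by apply/measurable_EFinP; exact: measurable_funX.
  by apply/measurable_EFinP; exact: measurable_normal_pdf.
- apply: emeasurable_funM => //.
  by apply/measurable_EFinP; exact: measurable_normal_pdf.
move=> x _; rewrite -!EFinM lee_fin /normal_pdf oner_eq0 pnatr_eq0/=.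
rewrite /normal_fun /k subr0.
have -> : 4 * normal_peak 1 / normal_peak 2 * (normal_peak 2 * expR (- x ^+ 2 / (2 ^+ 2 *+ 2))) =
    normal_peak 1 * (4 * expR (- x ^+ 2 / (2 ^+ 2 *+ 2))).
  by field; rewrite gt_eqF.
rewrite mulrCA ler_wpM2l ?normal_peak_ge0//.
have -> : - x ^+ 2 / (1 ^+ 2 *+ 2) = - x ^+ 2 / (2 ^+ 2 *+ 2) + - (3 / 8 * x ^+ 2).
  by field.
rewrite expRD mulrCA [leRHS]mulrC ler_wpM2l ?expR_ge0//.
rewrite expRN ler_pdivrMr ?expR_gt0//.
have := expR_ge1Dx (3 / 8 * x ^+ 2); have := sqr_ge0 x; lra.
Qed.

End gaussian_second_moment.

(** * Second moments of stochastic integrals *)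

Section white_noise_theory.
Context {R : realType} {d : nat} {disp : measure_display}.
Context {Omega : measurableType disp} (P : probability Omega R).
Context (T : R) (W : (measurableTypeR R * Rn R d -> R) -> Omega -> R).
Hypothesis wn : white_noise P T W.
Local Notation mR := (measurableTypeR R).
Local Notation st := (@spacetime R d).
Local Notation L2 := (in_L2 st (cylinder T)).
Implicit Types g f : mR * Rn R d -> R.

Let mcyl : measurable (cylinder T) := @measurable_cylinder R d T.

Let m2 : R := fine (@gaussian_moment2 R).

Let measurable_sqrW g : L2 g -> measurable_fun setT (fun omega => (W g omega ^+ 2)%:E).
Proof.
move=> gL2; apply/measurable_EFinP; apply: measurable_funX.
exact: (white_noise_measurable wn gL2).
Qed.

(** An integrand of norm 0 has the Dirac law at 0. *)
Lemma white_noise_null g : L2 g -> fine (L2norm st (cylinder T) g) = 0 ->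
  {ae P, forall omega, W g omega = 0}.
Proof.
move=> gL2 g0; have mg := white_noise_measurable wn gL2.
have mc : measurable (~` [set (0 : R)]) by exact: measurableC.
exists (W g @^-1` (~` [set 0])); split => //.
- by rewrite -[X in measurable X]setTI; exact: mg.
- rewrite (white_noise_gaussian wn gL2)// g0 /gaussian_law eqxx diracE memNset//=.
Qed.

Lemma white_noise_scale (a : R) g : L2 g ->
  {ae P, forall omega, W (fun z => a * g z) omega = a * W g omega}.
Proof.
move=> gL2.
have h0 : L2 (fun=> 0).
  have := in_L2_scale mcyl 0 gL2; congr (in_L2 _ _ _).
  by apply/funext => z; rewrite mul0r.
have W0 : {ae P, forall omega, W (fun=> 0) omega = 0}.
  apply: white_noise_null => //; apply/eqP; rewrite -sqrf_eq0 sqr_fine_L2norm//.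
  under eq_Rintegral do rewrite expr0n/=.
  by rewrite Rintegral_cst// mul0r.
have := white_noise_linear wn a gL2 h0; apply: filterS2 W0 => omega e0 e1.
rewrite e0 addr0 in e1; rewrite -e1; congr (W _ _).
by apply/funext => z; rewrite addr0.
Qed.

(** The Ito isometry, up to the factor [m2].  By linearity the integrand can be
    normalized to norm 1, where the law is the standard Gaussian one. *)
Lemma integral_sqr_white_noise g : L2 g ->
  (\int[P]_omega (W g omega ^+ 2)%:E =
   (m2 * \int[st]_(z in cylinder T) (g z ^+ 2))%:E)%E.
Proof.
move=> gL2; rewrite -sqr_fine_L2norm//.
set s := fine (L2norm st (cylinder T) g).
have [s0|s0] := eqVneq s 0.
  rewrite s0 expr0n/= mulr0 (ge0_ae_eq_integral (g := cst 0%E))//.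
  - by rewrite integral0.
  - exact: measurable_sqrW.
  - by move=> omega _; rewrite lee_fin exprn_even_ge0.
  - have := white_noise_null gL2 s0; apply: filterS => omega e _.
    by rewrite e expr0n.
pose f z := s^-1 * g z.
have fL2 : L2 f by exact: in_L2_scale.
have /in_L2P[mg ig] := gL2.
have sg : 0 <= s by rewrite fine_ge0// /L2norm poweR_ge0.
have f1 : fine (L2norm st (cylinder T) f) = 1.
  apply/eqP; rewrite -(@eqrXn2 _ 2)//; last by rewrite fine_ge0// /L2norm poweR_ge0.
  rewrite sqr_fine_L2norm// /f; under eq_Rintegral do rewrite exprMn.
  rewrite RintegralZl// -sqr_fine_L2norm// -/s -exprMn mulVf//.
have lawf : (\int[P]_omega (W f omega ^+ 2)%:E = m2%:E)%E.
  rewrite /m2 fineK ?gaussian_moment2_fin// /gaussian_moment2.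
  have mf : measurable_fun setT (W f : Omega -> mR) := white_noise_measurable wn fL2.
  pose mfm := @isMeasurableFun.Build _ _ Omega mR (W f) mf.
  pose X : {RV P >-> mR} := HB.pack (W f : Omega -> mR) mfm.
  transitivity (\int[distribution P X]_y ((y : R) ^+ 2)%:E)%E.
    rewrite ge0_integral_distribution//.
    - by apply/measurable_EFinP; exact: measurable_funX.
    - by move=> y; rewrite lee_fin exprn_even_ge0.
  have law (A : set mR) : measurable A -> A `<=` setT -> distribution P X A = normal_prob 0 1 A.
    move=> mA _; transitivity (gaussian_law 0 (fine (L2norm st (cylinder T) f)) A).
      exact: (white_noise_gaussian wn fL2 mA).
    by rewrite f1 /gaussian_law oner_eq0.
  exact: (eq_measure_integral (normal_prob 0 1) law).
rewrite mulrC EFinM -lawf -ge0_integralZl//; first last.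
- by rewrite lee_fin exprn_ge0.
- by move=> omega _; rewrite lee_fin exprn_even_ge0.
- exact: measurable_sqrW.
apply: ge0_ae_eq_integral => //.
- exact: measurable_sqrW.
- by apply: emeasurable_funM => //; exact: measurable_sqrW.
- by move=> omega _; rewrite lee_fin exprn_even_ge0.
- by move=> omega _; rewrite -EFinM lee_fin mulr_ge0 ?exprn_even_ge0.
- have := white_noise_scale s^-1 gL2; apply: filterS => omega e _.
  by rewrite e -EFinM -exprMn mulrA mulfV// mul1r.
Qed.

Lemma white_noise_sub_sum (I : Type) (r : seq I) (c : I -> R)
    (phi : I -> mR * Rn R d -> R) g :
  L2 g -> (forall i, L2 (phi i)) ->
  L2 (fun z => g z - \sum_(i <- r) c i * phi i z) /\
  {ae P, forall omega, W (fun z => g z - \sum_(i <- r) c i * phi i z) omega =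
    W g omega - \sum_(i <- r) c i * W (phi i) omega}.
Proof.
move=> gL2 phiL2; elim: r => [|i r [IHL2 IH]].
  have -> : (fun z => g z - \sum_(i <- [::]) c i * phi i z) = g.
    by apply/funext => z; rewrite big_nil subr0.
  by split => //; apply: aeW => omega; rewrite big_nil subr0.
have e : (fun z => g z - \sum_(i <- i :: r) c i * phi i z) =
    (fun z => (- c i) * phi i z + (g z - \sum_(i <- r) c i * phi i z)).
  by apply/funext => z; rewrite big_cons; ring.
rewrite e; split; first exact: in_L2_lin.
have := white_noise_linear wn (- c i) (phiL2 i) IHL2.
apply: filterS2 IH => omega e1 e2; rewrite e2 e1 big_cons; ring.
Qed.

End white_noise_theory.

(** * The cells of the grid *)

Section cells.
Context {R : realType} {d : nat} (T : R) (N J : nat).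
Hypotheses (T0 : 0 < T) (N0 : (0 < N)%N) (J0 : (0 < J)%N).
Local Notation mR := (measurableTypeR R).
Local Notation lebR := (@lebesgue_measure R).
Local Notation st := (@spacetime R d).
Local Notation dt := (dt T N).
Local Notation dx := (dx R J).

Lemma dt_gt0 : 0 < dt. Proof. by rewrite divr_gt0// ltr0n. Qed.

Lemma dx_gt0 : 0 < dx. Proof. by rewrite divr_gt0// ltr0n. Qed.

Lemma mulr_dt : N%:R * dt = T.
Proof. by rewrite /Defs.dt mulrC divfK// pnatr_eq0 -lt0n. Qed.

Lemma mulr_dx : J%:R * dx = 1.
Proof. by rewrite /Defs.dx mulrC divfK// pnatr_eq0 -lt0n. Qed.

(** Pairing the indices makes the double sum of [reg_noise] a single one. *)
Definition cell_index : Type := ('I_N * {ffun 'I_d -> 'I_J})%type.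
HB.instance Definition _ := Finite.on cell_index.

Definition cell_of (i : cell_index) := cell T i.1 i.2.

Definition cell_volume : R := dt * dx ^+ d.

Lemma cell_volume_gt0 : 0 < cell_volume.
Proof. by rewrite mulr_gt0 ?exprn_gt0 ?dt_gt0 ?dx_gt0. Qed.

Lemma cell_ofE i : cell_of i = st_box (i.1%:R * dt) (i.1.+1%:R * dt)
  (fun j => (i.2 j)%:R * dx) (fun j => (i.2 j).+1%:R * dx).
Proof.
apply/seteqP; split => -[s y]; rewrite /cell_of /cell /st_box /oo /=.
  move=> [/andP[h1 h2] h]; split; first by rewrite /= in_itv/= h1 h2.
  by move=> j; rewrite /= in_itv/=; exact: h.
move=> [h1 h]; split; first by move: h1; rewrite /= in_itv.
by move=> j; have := h j; rewrite /= in_itv.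
Qed.

Lemma measurable_cell i : measurable (cell_of i).
Proof. by rewrite cell_ofE; exact: measurable_st_box. Qed.

Lemma cell_time_bounds (n : 'I_N) : 0 <= n%:R * dt <= n.+1%:R * dt /\ n.+1%:R * dt <= T.
Proof.
have h := dt_gt0; split.
  by rewrite mulr_ge0 ?(ltW h)//= ler_wpM2r ?(ltW h)// ler_nat.
by rewrite -[leRHS]mulr_dt ler_wpM2r ?(ltW h)// ler_nat.
Qed.

Lemma cell_space_bounds (j : 'I_J) : 0 <= j%:R * dx /\ j.+1%:R * dx <= 1.
Proof.
have h := dx_gt0; split; first by rewrite mulr_ge0 ?(ltW h).
by rewrite -[leRHS]mulr_dx ler_wpM2r ?(ltW h)// ler_nat.
Qed.

Lemma cell_length (a : R) n : n.+1%:R * a - n%:R * a = a.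
Proof. by rewrite -natr1 mulrDl mul1r addrAC subrr add0r. Qed.

Lemma spacetime_cell i : st (cell_of i) = cell_volume%:E.
Proof.
have [/andP[_ h] _] := cell_time_bounds i.1.
rewrite cell_ofE /st_box.
set A := oo _ _; set B := box _.
transitivity ((lebR \x leb R d)%E (A `*` B)); first by [].
rewrite product_measure1E//; first last.
- by apply: measurable_box => j; exact: measurable_oo.
- exact: measurable_oo.
rewrite leb_box; last by move=> j; exact: measurable_oo.
rewrite /cell_volume EFinM; congr (_ * _)%E.
  exact: (etrans (lebesgue_measure_oo h) (congr1 EFin (cell_length _ _))).
rewrite (eq_bigr (fun=> dx%:E)).
  by rewrite prodEFin prodr_const card_ord.
move=> j _; have h' : (i.2 j)%:R * dx <= (i.2 j).+1%:R * dx.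
  by rewrite ler_wpM2r ?(ltW dx_gt0)// ler_nat.
exact: (etrans (lebesgue_measure_oo h') (congr1 EFin (cell_length _ _))).
Qed.

Lemma cell_sub_cylinder i : cell_of i `<=` cylinder T.
Proof.
have [/andP[p0 _] qT] := cell_time_bounds i.1.
move=> [s y] [/= /andP[ps sq] h]; split => /=.
  by rewrite in_itv/= (le_lt_trans p0 ps) (lt_le_trans sq qT).
move=> j; have /andP[ay yb] := h j; have [a0 b1] := cell_space_bounds (i.2 j).
by rewrite (le_lt_trans a0 ay) (lt_le_trans yb b1).
Qed.

Lemma grid_unique (a x : R) (m n : nat) : 0 < a ->
  m%:R * a < x -> x < m.+1%:R * a -> n%:R * a < x -> x < n.+1%:R * a -> m = n.
Proof.
move=> a0 h1 h2 h3 h4; apply/eqP; rewrite eqn_leq.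
have := lt_trans h1 h4; rewrite ltr_pM2r// ltr_nat ltnS => ->.
by have := lt_trans h3 h2; rewrite ltr_pM2r// ltr_nat ltnS => ->.
Qed.

Lemma cell_disjoint i j z : cell_of i z -> cell_of j z -> i = j.
Proof.
case: i j => [n mu] [n' mu'] [/= /andP[h1 h2] h] [/= /andP[h1' h2'] h'].
congr pair; first by apply/val_inj/(grid_unique dt_gt0 h1 h2 h1' h2').
apply/ffunP => k; apply/val_inj.
by have /andP[a b] := h k; have /andP[a' b'] := h' k; exact: (grid_unique dx_gt0 a b a' b').
Qed.

End cells.

(** * The mean square error as a sum over modes *)

Section mean_square_error_formula.
Context {R : realType} {d : nat} (hd : d = 2%N \/ d = 3%N).
Context (T : R) (N J : nat).
Hypotheses (T0 : 0 < T) (N0 : (0 < N)%N) (J0 : (0 < J)%N).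
Local Notation mR := (measurableTypeR R).
Local Notation lebR := (@lebesgue_measure R).
Local Notation st := (@spacetime R d).
Local Notation dt := (dt T N).
Local Notation dx := (dx R J).
Local Notation v := (cell_volume (d := d) T N J).
Local Notation index := (cell_index (d := d) N J).
Local Notation S := (cell_of T (N := N) (J := J) (d := d)).

Let d_gt0 : (0 < d)%N. Proof. by case: hd => ->. Qed.
Let T_ge0 : 0 <= T. Proof. exact: ltW. Qed.
Let mcyl : measurable (cylinder T) := @measurable_cylinder R d T.
Let m2 : R := fine (@gaussian_moment2 R).

Lemma integrable_mild_sqr t x :
  st.-integrable (cylinder T) (EFin \o (fun z => @mild_integrand R d t x z ^+ 2)).
Proof.
apply/integrableP; split.
  apply/measurable_EFinP; apply: measurable_funX; apply: measurable_funTS.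
  exact: measurable_mild_integrand.
rewrite (eq_integral (fun z => (@mild_integrand R d t x z ^+ 2)%:E)).
  by rewrite integral_mild_sqr// ltry.
by move=> z _; rewrite /= ger0_norm// exprn_even_ge0.
Qed.

Lemma Rintegral_mild_sqr t x :
  \int[st]_(z in cylinder T) (@mild_integrand R d t x z ^+ 2) =
  limn (boxsum (energy_term t T x)).
Proof. by rewrite /Rintegral integral_mild_sqr. Qed.

Lemma in_L2_mild t x : in_L2 st (cylinder T) (@mild_integrand R d t x).
Proof.
apply/in_L2P; split; last exact: integrable_mild_sqr.
by apply: measurable_funTS; exact: measurable_mild_integrand.
Qed.

Lemma spacetime_cylinder_lty : (st (cylinder T) < +oo)%E.
Proof.
have -> : st (cylinder T) = T%:E; last exact: ltry.
transitivity ((lebR \x leb R d)%E (oo 0 T `*` cube)); first by [].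
rewrite product_measure1E//; [|exact: measurable_oo|exact: measurable_cube].
have h : lebR (oo 0 T) = T%:E.
  exact: (etrans (lebesgue_measure_oo T_ge0) (congr1 EFin (subr0 _))).
by rewrite [X in (X * _)%E]h leb_cube mule1.
Qed.

Lemma in_L2_indic (A : set (mR * Rn R d)) : measurable A ->
  in_L2 st (cylinder T) (\1_A : _ -> R).
Proof.
move=> mA; apply: (@in_L2_bounded _ _ _ _ _ mcyl _ 1).
- exact: spacetime_cylinder_lty.
- exact: measurable_indic.
- by move=> z _; rewrite indicE; case: (_ \in _); rewrite /= ?normr1 ?normr0.
Qed.

Definition cell_mass t x (i : index) : R :=
  \int[st]_(z in S i) @mild_integrand R d t x z.

Section with_noise.
Context {disp : measure_display} {Omega : measurableType disp}.
Context (P : probability Omega R) (W : (mR * Rn R d -> R) -> Omega -> R).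
Context (u : R -> Rn R d -> Omega -> R).
Hypotheses (wn : white_noise P T W) (mu : mild_solution P T W u).
Local Notation ureg := (reg_solution T N J W).

(** The regularized noise is, for each outcome, a step function, so its integral
    against the kernel is a sum over cells: [ureg] is the stochastic integral of
    the cell averages of the mild integrand. *)
Lemma reg_solutionE t x omega : 0 <= t <= T ->
  ureg t x omega = \sum_i (v^-1 * cell_mass t x i) * W (\1_(S i)) omega.
Proof.
move=> /andP[t0 tT].
have mct : measurable (cylinder t) := @measurable_cylinder R d t.
have subt : @cylinder R d t `<=` cylinder T.
  move=> [s y] [/= h1 h2]; split => //=; move: h1; rewrite !in_itv/= => /andP[-> h].
  exact: lt_le_trans h tT.
have ig : st.-integrable (cylinder t) (EFin \o mild_integrand t x).
  exact: integrable_mild_integrand.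
have igS (i : index) : st.-integrable (cylinder t) (EFin \o (mild_integrand t x) \_ (S i)).
  by apply: (integrable_patch mct) => //; exact: measurable_cell.
rewrite /reg_solution.
transitivity (\int[st]_(z in cylinder t) (\sum_(i : index)
    (v^-1 * W (\1_(S i)) omega) * ((mild_integrand t x) \_ (S i)) z)).
  apply: eq_Rintegral => z /set_mem[/= zt _].
  rewrite /reg_noise pair_bigA/= mulrCA mulr_sumr mulr_sumr; apply: eq_bigr => i _.
  rewrite -mulrA; congr (_ * _); rewrite /mild_integrand /patch indicE /cell_of.
  case: (boolP (z \in _)) => zS; last by rewrite mul0r !mulr0.
  by rewrite indicE mem_set//= !mul1r mulrC.
rewrite (Rintegral_bigsum mct); last by move=> i; exact: (integrableZ_EFin mct).
apply: eq_bigr => i _; rewrite RintegralZl// mulrAC; congr (_ * _ * _).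
rewrite -Rintegral_mkcondr Rintegral_mkcondl; apply: eq_Rintegral => z /set_mem zS.
rewrite /patch; case: ifPn => // /negP zt.
rewrite /mild_integrand indicE memNset ?mul0r// => z1t; apply: zt; apply/mem_set; split => //.
by have [] := cell_sub_cylinder T0 N0 J0 zS.
Qed.

(** The squared norm of the mild integrand minus that of its cell averages. *)
Definition projection_error t x : R :=
  limn (boxsum (energy_term t T x)) - v^-1 * \sum_i cell_mass t x i ^+ 2.

Let cell_L2 (i : index) : in_L2 st (cylinder T) (\1_(S i) : _ -> R).
Proof. by apply: in_L2_indic; exact: measurable_cell. Qed.

Lemma integral_sqr_sub_averages t x :
  \int[st]_(z in cylinder T) (@mild_integrand R d t x z -
     \sum_i (v^-1 * cell_mass t x i) * \1_(S i) z) ^+ 2 = projection_error t x.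
Proof.
rewrite /projection_error -Rintegral_mild_sqr.
apply: (Rintegral_sqr_sub_averages mcyl (S := S)).
- exact: cell_volume_gt0.
- exact: measurable_cell.
- exact: cell_sub_cylinder.
- by move=> i; rewrite spacetime_cell.
- by move=> i; rewrite spacetime_cell// ltry.
- exact: cell_disjoint.
- exact: integrable_mild_integrand.
- exact: integrable_mild_sqr.
Qed.

Lemma measurable_W_cell (i : index) : measurable_fun setT (W (\1_(S i))).
Proof. exact: (white_noise_measurable wn (cell_L2 i)). Qed.

(** Almost surely the error is the stochastic integral of the mild integrand
    minus its cell averages, so that [integral_sqr_white_noise] and Pythagoras
    apply. *)
Lemma integral_sqr_error t x : 0 <= t <= T -> cube x ->
  (\int[P]_omega ((u t x omega - ureg t x omega) ^+ 2)%:E =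
   (m2 * projection_error t x)%:E)%E.
Proof.
move=> tT xcube.
have [hL2 haff] := @white_noise_sub_sum _ _ _ _ P T W wn index (index_enum _)
  (fun i => v^-1 * cell_mass t x i) (fun i => \1_(S i)) _ (in_L2_mild t x) cell_L2.
rewrite -integral_sqr_sub_averages -(integral_sqr_white_noise wn hL2).
have mu1 : measurable_fun setT (u t x).
  apply: (@measurable_comp _ _ _ _ _ _ (cube `*` setT)
    (fun z : Rn R d * Omega => u t z.1 z.2) _ (fun omega => (x, omega))) => //.
  - by apply: measurableX => //; exact: measurable_cube.
  - by move=> _ [omega _ <-].
  - exact: (mild_solution_measurable mu tT).
  - exact: measurable_pair1.
apply: ge0_ae_eq_integral => //.
- apply/measurable_EFinP; apply: measurable_funX; apply: measurable_funB => //.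
  rewrite (_ : ureg t x = (fun omega =>
    \sum_i (v^-1 * cell_mass t x i) * W (\1_(S i)) omega)); last first.
    by apply/funext => omega; rewrite reg_solutionE.
  apply: measurable_sum => i; apply: measurable_funM => //.
  exact: measurable_W_cell.
- apply/measurable_EFinP; apply: measurable_funX.
  exact: (white_noise_measurable wn hL2).
- by move=> omega _; rewrite lee_fin exprn_even_ge0.
- by move=> omega _; rewrite lee_fin exprn_even_ge0.
have xcc : closed_cube x by move=> i; have /andP[a b] := xcube i; rewrite !ltW.
have := mild_solution_eq mu tT xcc; apply: filterS2 haff => omega e1 e2 _.
by rewrite e1 e2 reg_solutionE.
Qed.

(** The integral over the cell [i] of the mode [alpha] of the mild integrand. *)
Definition mild_cell_coef t (i : index) (alpha : 'I_d -> nat) : R :=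
  heat_int (rate alpha) t (i.1%:R * dt) (i.1.+1%:R * dt) *
  \prod_j \int[lebR]_(y in oo ((i.2 j)%:R * dx) ((i.2 j).+1%:R * dx)) sineb (alpha j) y.

Lemma cell_mass_cvg t x i :
  boxsum (fun alpha => eigfun alpha x * mild_cell_coef t i alpha) K @[K --> \oo] -->
  cell_mass t x i.
Proof.
rewrite /cell_mass cell_ofE.
have [h1 h2] := cell_time_bounds T0 N0 i.1.
have ha j : 0 <= (i.2 j)%:R * dx by have [] := cell_space_bounds (R := R) J0 (i.2 j).
have hb j : (i.2 j).+1%:R * dx <= 1 by have [] := cell_space_bounds (R := R) J0 (i.2 j).
exact: (@Rintegral_st_box_mild R d hd t x _ _ _ _ T h1 h2 ha hb).
Qed.

Lemma measurable_cell_mass t i : measurable_fun setT (fun x => cell_mass t x i).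
Proof.
apply: (@measurable_fun_cvg _ _ _ _
  (fun K x => boxsum (fun alpha => eigfun alpha x * mild_cell_coef t i alpha) K)).
- move=> K; apply: measurable_boxsum => alpha; apply: measurable_funM => //.
  exact: measurable_eigfun.
- by move=> x _; exact: cell_mass_cvg.
Qed.

(** Tonelli exchanges the expectation and the integral over the domain. *)
Lemma mean_square_errorE t : 0 <= t <= T ->
  mean_square_error P u ureg t =
  ((\int[leb R d]_(x in cube) (m2 * projection_error t x)%:E) `^ 2^-1)%E.
Proof.
move=> tT; rewrite /mean_square_error; congr (_ `^ _)%E.
under eq_integral do rewrite sqr_L2norm.
pose F (z : Rn R d * Omega) := ((u t z.1 z.2 - ureg t z.1 z.2) ^+ 2)%:E.
have mF : measurable_fun (cube `*` setT) F.
  apply/measurable_EFinP; apply: measurable_funX; apply: measurable_funB.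
    exact: (mild_solution_measurable mu tT).
  apply: measurable_funTS.
  rewrite (_ : (fun z : Rn R d * Omega => _) = (fun z : Rn R d * Omega =>
    \sum_i (v^-1 * cell_mass t z.1 i) * W (\1_(S i)) z.2)); last first.
    by apply/funext => z; rewrite reg_solutionE.
  apply: measurable_sum => i; apply: measurable_funM.
    apply: measurable_funM => //.
    apply: (@measurableT_comp _ _ _ _ _ _ (fun x => cell_mass t x i) _ fst) => //.
    exact: measurable_cell_mass.
  apply: (@measurableT_comp _ _ _ _ _ _ (W (\1_(S i))) _ snd) => //.
  exact: measurable_W_cell.
have F0 z : (cube `*` setT) z -> (0 <= F z)%E by rewrite lee_fin exprn_even_ge0.
have mc := @measurable_cube R d.
transitivity (\int[leb R d \x P]_(z in cube `*` setT) F z)%E.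
  by rewrite (fubini_tonelli_setX2 (leb R d) P mc measurableT mF F0).
rewrite (fubini_tonelli_setX1 (leb R d) P mc measurableT mF F0).
by apply: eq_integral => x /set_mem xcube; exact: integral_sqr_error.
Qed.

End with_noise.

(** The squared distance to the step functions of the mode [alpha] of the mild
    integrand. *)
Definition error_term t (alpha : 'I_d -> nat) : R :=
  heat_int (2 * rate alpha) t 0 T - v^-1 * \sum_i mild_cell_coef t i alpha ^+ 2.

Lemma norm_Rintegral_sineb (a b : R) k : 0 <= b - a <= 1 ->
  `|\int[lebR]_(y in oo a b) sineb k y| <= Num.sqrt 2.
Proof.
move=> /andP[ab ab1]; have mab : measurable (oo a b) by exact: measurable_oo.
have isin : lebR.-integrable (oo a b) (EFin \o sineb k).
  by apply: integrable_oo; exact: continuous_sineb.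
have ic : lebR.-integrable (oo a b) (EFin \o cst (Num.sqrt 2)).
  by apply: integrable_oo => y; exact: cvg_cst.
apply: (le_trans (le_normr_Rintegral mab isin)).
apply: (@le_trans _ _ (\int[lebR]_(y in oo a b) Num.sqrt 2)).
  apply: le_Rintegral => //; last by move=> y _; exact: sineb_norm.
  exact: (@integrable_norm _ _ _ _ _ _ isin).
rewrite Rintegral_cst//.
have -> : fine (lebR (oo a b)) = b - a.
  by rewrite subr_ge0 in ab; exact: (congr1 fine (lebesgue_measure_oo ab)).
by rewrite ler_piMr// sqrtr_ge0.
Qed.

Lemma mild_cell_coef_le t i alpha : positive_index alpha ->
  `|mild_cell_coef t i alpha| <= (rate alpha)^-1 * Num.sqrt 2 ^+ d.
Proof.
move=> a0; have r0 := rate_gt0 (R := R) d_gt0 a0.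
have [/andP[_ pq] _] := cell_time_bounds T0 N0 i.1.
rewrite /mild_cell_coef normrM ler_pM//.
  by rewrite ger0_norm ?heat_int_ge0// heat_int_le_inv.
rewrite normr_prod -[in leRHS](card_ord d) -prodr_const.
apply: ler_prod => j _; rewrite normr_ge0/= norm_Rintegral_sineb//.
rewrite cell_length (ltW (dx_gt0 J0))/= /Defs.dx mul1r.
by rewrite invf_le1 ?ltr0n// ler1n.
Qed.

Lemma projection_error_cvg t x :
  boxsum (energy_term t T x) K - v^-1 *
    \sum_(i : index) (boxsum (fun alpha => eigfun alpha x * mild_cell_coef t i alpha) K) ^+ 2
    @[K --> \oo] --> projection_error t x.
Proof.
apply: cvgB; first exact: is_cvg_energy.
apply: cvgM; first exact: cvg_cst.
apply: cvg_big => [|i _]; first exact: add_continuous.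
exact: (cvgM (@cell_mass_cvg t x i) (@cell_mass_cvg t x i)).
Qed.

(** The truncated projection errors are quadratic forms in the values
    [eigfun alpha x], bounded uniformly in [x] and in the truncation; integrated
    over [x], they become diagonal by orthonormality. *)
Lemma Rintegral_projection_error t : 0 <= t <= T ->
  (leb R d).-integrable cube (EFin \o projection_error t) /\
  boxsum (error_term t) K @[K --> \oo] -->
  \int[leb R d]_(x in cube) projection_error t x.
Proof.
move=> tT; have mc := @measurable_cube R d.
pose vK K x := boxsum (energy_term t T x) K - v^-1 *
    \sum_(i : index) (boxsum (fun alpha => eigfun alpha x * mild_cell_coef t i alpha) K) ^+ 2.
pose B : R := Num.sqrt 2 ^+ d * Num.sqrt 2 ^+ d * (2 * d%:R).
pose M : R := 2 ^+ d * (2 * d%:R) + v^-1 * \sum_(i : index) B ^+ 2.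
have v0 : 0 < v by exact: cell_volume_gt0.
have sB x K i : `|boxsum (fun alpha => eigfun alpha x * mild_cell_coef t i alpha) K| <= B.
  apply: (le_trans (@ler_norm_boxsum R d _
    (fun alpha => Num.sqrt 2 ^+ d * Num.sqrt 2 ^+ d * (rate alpha)^-1) K _)).
    move=> alpha a0; rewrite normrM -mulrA ler_pM ?eigfun_norm//.
    by rewrite mulrC mild_cell_coef_le.
  by rewrite boxsumZ ler_wpM2l ?boxsum_inv_rate_le// mulr_ge0 ?exprn_ge0 ?sqrtr_ge0.
have bound K x : `|vK K x| <= M.
  rewrite /vK (le_trans (ler_normB _ _))// lerD//.
    apply: (le_trans (@ler_norm_boxsum R d _ (fun alpha => 2 ^+ d * (rate alpha)^-1) K _)).
      move=> alpha a0; have /andP[e0 e1] := energy_term_bounds hd t x T_ge0 a0.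
      by rewrite ger0_norm.
    by rewrite boxsumZ ler_wpM2l ?boxsum_inv_rate_le ?exprn_ge0.
  rewrite normrM ger0_norm ?invr_ge0 ?(ltW v0)// ler_wpM2l ?invr_ge0 ?(ltW v0)//.
  rewrite (le_trans (ler_norm_sum _ _ _))// ler_sum// => i _.
  by rewrite normrX ler_sqr ?nnegrE ?sB// (le_trans _ (sB x K i)).
have meig K i : measurable_fun setT
    (fun x : Rn R d => boxsum (fun alpha => eigfun alpha x * mild_cell_coef t i alpha) K).
  by apply: measurable_boxsum => alpha; apply: measurable_funM => //; exact: measurable_eigfun.
have mvK K : measurable_fun cube (vK K).
  apply: measurable_funTS; apply: measurable_funB.
    apply: measurable_boxsum => alpha; apply: measurable_funM => //.
    by apply: measurable_funX; exact: measurable_eigfun.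
  apply: measurable_funM => //; apply: measurable_sum => i.
  exact: measurable_funX.
have iM : (leb R d).-integrable cube (EFin \o cst M).
  apply: (@bounded_integrable_EFin _ _ _ _ _ mc _ `|M|) => //.
  exact: leb_cube_lty.
have [iE cE] := @dominated_cvg_Rintegral _ _ _ (leb R d) cube mc vK (projection_error t)
  (cst M) mvK (fun x _ => @projection_error_cvg t x) iM (fun K x _ => bound K x).
split => //; move: cE; rewrite (_ : (fun K => _) = (fun K => boxsum (error_term t) K))//.
apply/funext => K; rewrite /vK.
have ie (a : {ffun 'I_d -> 'I_K}) : (leb R d).-integrable cube
    (EFin \o (fun x => eigfun (multi a) x ^+ 2)).
  exact: integrable_cube_eigfunM.
have is2 i : (leb R d).-integrable cube (EFin \o (fun x : Rn R d =>
    boxsum (fun alpha => eigfun alpha x * mild_cell_coef t i alpha) K ^+ 2)).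
  apply: (@bounded_integrable_EFin _ _ _ _ _ mc _ (B ^+ 2)) => //.
  - exact: leb_cube_lty.
  - by apply: measurable_funTS; apply: measurable_funX.
  - move=> x _; rewrite normrX ler_sqr ?nnegrE ?sB//.
    by rewrite (le_trans _ (sB x K i)).
have iterm (a : {ffun 'I_d -> 'I_K}) : (leb R d).-integrable cube
    (EFin \o (fun x => energy_term t T x (multi a))).
  rewrite (_ : (fun x => energy_term t T x (multi a)) =
    (fun x => heat_int (2 * rate (multi a)) t 0 T * eigfun (multi a) x ^+ 2)).
    exact: (integrableZ_EFin mc).
  by apply/funext => x; rewrite /energy_term mulrC.
rewrite RintegralB//; first last.
- by apply: (integrableZ_EFin mc); exact: (integrable_bigsum mc).
- exact: (integrable_bigsum mc).
rewrite (Rintegral_bigsum mc)// RintegralZl//; last exact: (integrable_bigsum mc).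
rewrite (Rintegral_bigsum mc)// boxsumB; congr (_ - _).
  apply: eq_bigr => a _; rewrite /energy_term RintegralZr//.
  have := @eigfun_orthonormal R d (multi a) (multi a) (positive_multi a) (positive_multi a).
  by rewrite big1 => [|j _]; [move=> e; rewrite [X in X * _]e mul1r|rewrite eqxx].
rewrite boxsumZ; congr (_ * _); rewrite /boxsum exchange_big/=; apply: eq_bigr => i _.
transitivity (\int[leb R d]_(x in cube)
    (boxsum (fun alpha => mild_cell_coef t i alpha * eigfun alpha x) K) ^+ 2).
  by apply: eq_Rintegral => x _; congr (_ ^+ 2); apply: eq_bigr => a _; rewrite mulrC.
by rewrite parseval.
Qed.

End mean_square_error_formula.

(** * Averages of the sines over the grid *)

Section cell_averages_of_sines.
Context {R : realType}.
Local Notation mR := (measurableTypeR R).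
Local Notation lebR := (@lebesgue_measure R).

Lemma Rintegral_sqr_subC (f : R -> R) (a b c : R) : a <= b -> continuous f ->
  \int[lebR]_(y in oo a b) (f y - c) ^+ 2 =
  \int[lebR]_(y in oo a b) (f y ^+ 2) - 2 * c * \int[lebR]_(y in oo a b) f y +
  c ^+ 2 * (b - a).
Proof.
move=> ab cf; have mab : measurable (oo a b) by exact: measurable_oo.
have i1 : lebR.-integrable (oo a b) (EFin \o f) by exact: integrable_oo.
have i2 : lebR.-integrable (oo a b) (EFin \o (fun y => f y ^+ 2)).
  by apply: integrable_oo => y; exact: (cvgM (cf y) (cf y)).
have ic : lebR.-integrable (oo a b) (EFin \o cst (c ^+ 2)).
  by apply: integrable_oo => y; exact: cvg_cst.
have iZ := integrableZ_EFin mab (2 * c) i1.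
transitivity (\int[lebR]_(y in oo a b) ((f y ^+ 2 - 2 * c * f y) + c ^+ 2)).
  by apply: eq_Rintegral => y _; ring.
rewrite (RintegralD mab _ ic); last exact: (integrableB_EFin mab).
rewrite RintegralB// RintegralZl// Rintegral_cst//.
by have -> : fine (lebR (oo a b)) = b - a by exact: (congr1 fine (lebesgue_measure_oo ab)).
Qed.

(** The mean is the best constant approximation of [f] in the mean square: the
    quantity in the middle is the squared distance of [f] to its mean, hence
    nonnegative and at most the squared distance of [f] to [c]. *)
Lemma variance_bounds (f : R -> R) (a b c M : R) : a < b -> continuous f ->
  (forall y, a < y < b -> `|f y - c| <= M) ->
  0 <= \int[lebR]_(y in oo a b) (f y ^+ 2) - (b - a)^-1 * (\int[lebR]_(y in oo a b) f y) ^+ 2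
    <= (b - a) * M ^+ 2.
Proof.
move=> ab cf fM; have mab : measurable (oo a b) by exact: measurable_oo.
have ab0 : 0 < b - a by rewrite subr_gt0.
set I := \int[lebR]_(y in oo a b) f y.
apply/andP; split.
  have := Rintegral_sqr_subC ((b - a)^-1 * I) (ltW ab) cf; rewrite -/I => e.
  have : 0 <= \int[lebR]_(y in oo a b) (f y - (b - a)^-1 * I) ^+ 2.
    by apply: Rintegral_ge0 => y _; rewrite exprn_even_ge0.
  rewrite e; suff -> : 2 * ((b - a)^-1 * I) * I = (b - a)^-1 * I ^+ 2 +
      ((b - a)^-1 * I) ^+ 2 * (b - a) by lra.
  by field; rewrite gt_eqF.
have h : \int[lebR]_(y in oo a b) (f y - c) ^+ 2 <= (b - a) * M ^+ 2.
  apply: (@le_trans _ _ (\int[lebR]_(y in oo a b) (M ^+ 2))).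
    apply: le_Rintegral => //.
    - apply: integrable_oo => y; have h : f x - c @[x --> y] --> f y - c.
        by apply: cvgB; [exact: cf|exact: cvg_cst].
      exact: (cvgM h h).
    - by apply: integrable_oo => y; exact: cvg_cst.
    - move=> y; rewrite /oo/= in_itv/= => yab.
      rewrite -[leLHS]real_normK ?num_real// ler_sqr ?nnegrE ?fM//.
      by rewrite (le_trans _ (fM y yab)).
  rewrite Rintegral_cst// mulrC.
  by have -> : fine (lebR (oo a b)) = b - a by exact: (congr1 fine (lebesgue_measure_oo (ltW ab))).
apply: le_trans h; rewrite (Rintegral_sqr_subC c (ltW ab) cf) -/I.
have : 0 <= (b - a)^-1 * (I - c * (b - a)) ^+ 2.
  by rewrite mulr_ge0 ?invr_ge0 ?(ltW ab0)// exprn_even_ge0.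
suff -> : (b - a)^-1 * (I - c * (b - a)) ^+ 2 =
    (b - a)^-1 * I ^+ 2 - 2 * c * I + c ^+ 2 * (b - a) by lra.
by field; rewrite gt_eqF.
Qed.

Lemma sin_lipschitz (x y : R) : `|sin x - sin y| <= `|x - y|.
Proof.
wlog xy : x y / x <= y.
  move=> h; have [xy|/ltW yx] := leP x y; first exact: h.
  by rewrite distrC [leRHS]distrC; exact: h.
have [c _] := @MVT_segment R sin cos x y xy (fun z _ => is_derive_sin z)
  (continuous_subspaceT (@continuous_sin R)).
rewrite distrC [leRHS]distrC => ->.
by rewrite normrM ler_piMl// cos_max.
Qed.

Lemma sineb_lipschitz k (x y : R) :
  `|sineb k x - sineb k y| <= Num.sqrt 2 * (k%:R * pi * `|x - y|).
Proof.
rewrite /sineb -mulrBr normrM ger0_norm ?sqrtr_ge0// ler_wpM2l ?sqrtr_ge0//.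
rewrite (le_trans (sin_lipschitz _ _))// -mulrBr normrM.
by rewrite ger0_norm// mulr_ge0 ?pi_ge0.
Qed.

(** The squared norm of the function made of the cell averages of [sineb k]. *)
Definition grid_energy (J k : nat) : R :=
  (dx R J)^-1 * \sum_(m < J)
    (\int[lebR]_(y in oo (m%:R * dx R J) (m.+1%:R * dx R J)) sineb k y) ^+ 2.

Lemma Rintegral_sineb_sqr_grid (J k : nat) : (0 < J)%N -> (0 < k)%N ->
  \sum_(m < J) \int[lebR]_(y in oo (m%:R * dx R J) (m.+1%:R * dx R J)) (sineb k y ^+ 2) = 1.
Proof.
move=> J0 k0; have dx0 := dx_gt0 (R := R) J0.
have kpi : 2 * (k%:R * pi) != 0 :> R.
  by rewrite !mulf_neq0 ?pnatr_eq0 -?lt0n// gt_eqF// pi_gt0.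
pose F (y : R) := y - (2 * (k%:R * pi))^-1 * sin (2 * (k%:R * pi) * y).
have e y : sineb k y ^+ 2 = 1 - cos (2 * (k%:R * pi) * y).
  rewrite /sineb exprMn sqr_sqrtr// sin2cos2.
  have -> : 2 * (k%:R * pi) * y = (k%:R * pi * y) *+ 2 by ring.
  by rewrite cos_mulr2n; ring.
have cF : continuous (fun y : R => sineb k y ^+ 2).
  by move=> y; exact: (cvgM (@continuous_sineb R k y) (@continuous_sineb R k y)).
have dF y : is_derive y (1 : R) F (sineb k y ^+ 2).
  have h := @is_derive_scale R sin (cos (2 * (k%:R * pi) * y)) (2 * (k%:R * pi)) y (is_derive_sin _).
  rewrite e (_ : F = id - (2 * (k%:R * pi))^-1 *: (fun y => sin (2 * (k%:R * pi) * y)))//.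
  by apply: is_derive_eq; rewrite /GRing.scale/= mulKf.
have cell (m : 'I_J) : \int[lebR]_(y in oo (m%:R * dx R J) (m.+1%:R * dx R J)) (sineb k y ^+ 2) =
    F (m.+1%:R * dx R J) - F (m%:R * dx R J).
  by apply: (Rintegral_FTC _ cF dF); rewrite ler_wpM2r ?(ltW dx0)// ler_nat.
rewrite (eq_bigr _ (fun m _ => cell m)).
rewrite -(big_mkord xpredT (fun m => F (m.+1%:R * dx R J) - F (m%:R * dx R J))).
rewrite (telescope_sumr (fun m => F (m%:R * dx R J)))// mulr_dx// mul0r /F !mulr0 sin0 mulr1.
by rewrite mulrA -natrM sin_natpi !mulr0 !subr0.
Qed.

(** Sum over the cells of [variance_bounds], with [c] the value of the sine at the
    left end of the cell and the Lipschitz bound as [M]. *)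
Lemma grid_energy_bounds (J k : nat) : (0 < J)%N -> (0 < k)%N ->
  0 <= grid_energy J k <= 1 /\ 1 - grid_energy J k <= 2 * (k%:R * pi * dx R J) ^+ 2.
Proof.
move=> J0 k0; have dx0 := dx_gt0 (R := R) J0.
pose s (m : 'I_J) := \int[lebR]_(y in oo (m%:R * dx R J) (m.+1%:R * dx R J)) sineb k y.
pose q (m : 'I_J) := \int[lebR]_(y in oo (m%:R * dx R J) (m.+1%:R * dx R J)) (sineb k y ^+ 2).
pose M := Num.sqrt 2 * (k%:R * pi * dx R J).
have qs (m : 'I_J) : 0 <= q m - (dx R J)^-1 * s m ^+ 2 <= dx R J * M ^+ 2.
  have ab : m%:R * dx R J < m.+1%:R * dx R J by rewrite ltr_pM2r// ltr_nat.
  have := @variance_bounds (sineb k) _ _ (sineb k (m%:R * dx R J)) M ab (@continuous_sineb R k).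
  rewrite cell_length; apply => y /andP[ay yb].
  rewrite (le_trans (sineb_lipschitz _ _ _))// /M ler_wpM2l ?sqrtr_ge0//.
  rewrite ler_wpM2l ?mulr_ge0 ?pi_ge0// ger0_norm ?subr_ge0 ?(ltW ay)//.
  by have := cell_length (dx R J) m; lra.
have e : 1 - grid_energy J k = \sum_(m < J) (q m - (dx R J)^-1 * s m ^+ 2).
  by rewrite -(Rintegral_sineb_sqr_grid J0 k0) /grid_energy sumrB mulr_sumr.
have h0 : 0 <= 1 - grid_energy J k by rewrite e sumr_ge0// => m _; have /andP[] := qs m.
split.
  apply/andP; split; last by rewrite -subr_ge0.
  rewrite /grid_energy mulr_ge0 ?invr_ge0 ?(ltW dx0)//.
  by rewrite sumr_ge0// => m _; rewrite exprn_even_ge0.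
rewrite e; apply: (@le_trans _ _ (\sum_(m < J) dx R J * M ^+ 2)).
  by apply: ler_sum => m _; have /andP[] := qs m.
rewrite sumr_const card_ord -[leLHS]mulr_natl mulrA mulr_dx// mul1r.
by rewrite /M exprMn sqr_sqrtr.
Qed.

(** Interpolates between the two bounds 1 and 2 pi^2 X^2 of the defect, for
    X = k dx, since min(1, X^2) <= X^p. *)
Lemma grid_defect_le (J k : nat) (p : R) : (0 < J)%N -> (0 < k)%N -> 0 <= p <= 2 ->
  1 - grid_energy J k <= 2 * pi ^+ 2 * (k%:R * dx R J) `^ p.
Proof.
move=> J0 k0 /andP[p0 p2]; have [/andP[g0 g1] g2] := grid_energy_bounds J0 k0.
have dx0 := dx_gt0 (R := R) J0.
set X := k%:R * dx R J.
have X0 : 0 < X by rewrite mulr_gt0// ltr0n.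
have pi2 : 1 <= 2 * pi ^+ 2 :> R.
  have : 1 <= pi ^+ 2 :> R by rewrite exprn_ege1// (le_trans _ (pi_ge2 R))// ler1n.
  lra.
have [X1|X1] := leP X 1.
  apply: (le_trans g2); have -> : 2 * (k%:R * pi * dx R J) ^+ 2 = 2 * pi ^+ 2 * X ^+ 2.
    by rewrite /X; ring.
  rewrite ler_wpM2l ?(le_trans _ pi2)// -(powR_mulrn 2 (ltW X0)).
  by apply: ger_powR => //; rewrite X0 X1.
apply: (@le_trans _ _ 1); first by lra.
rewrite -[leLHS]mulr1 ler_pM//.
by rewrite -(powRr0 X) ler_powR// ltW.
Qed.

End cell_averages_of_sines.

(** * Averages of the exponentials in time *)

Section time_averages.
Context {R : realType}.
Implicit Types L t p q : R.

Let decay L t p : R := expR (- L * (t - Num.min p t)).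

(** On a cell the defect of a monotone function is at most the length of the
    cell times the increment of its square; the first term of the bound is this
    increment for the exponential.  On the cell where [heat L t] drops to 0 the
    jump costs at most the length of the cell, which is the second term.  Both
    terms telescope when summed over cells. *)
Lemma heat_cell_defect L t p q : 0 < L -> p < q ->
  heat_int (2 * L) t p q - (q - p)^-1 * heat_int L t p q ^+ 2 <=
  (q - p) * (decay L t q ^+ 2 - decay L t p ^+ 2) + (q - p) * ((p < t)%R%:R - (q < t)%R%:R).
Proof.
move=> L0 pq.
have dd r : expR (- (2 * L) * (t - Num.min r t)) = decay L t r ^+ 2.
  by rewrite /decay expr2 -expRD; congr expR; ring.
rewrite /heat_int !dd -!/(decay L t _).
set a := decay L t p; set b := decay L t q.
(* length of the part of the cell that precedes t *)
pose l := Num.min q t - Num.min p t.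
have a0 : 0 < a by exact: expR_gt0.
have b0 : 0 < b by exact: expR_gt0.
have a1 : a <= 1 by exact: expR_decay_le1 (ltW L0).
have ab : a <= b by exact: expR_decay_mono (ltW L0) (ltW pq).
have lb : b = a * expR (L * l) by rewrite /a /b /decay -expRD; congr expR; rewrite /l; ring.
have la : a = b * expR (- (L * l)) by rewrite lb -mulrA -expRD subrr expR0 mulr1.
have l0 : 0 <= l.
  by rewrite subr_ge0 le_min !ge_min lexx (ltW pq) !orbT.
have ld : l <= q - p.
  rewrite /l; case: (leP q t) => h; case: (leP p t) => h'; lra.
have h1 : (b ^+ 2 - a ^+ 2) / (2 * L) <= l * b ^+ 2.
  rewrite ler_pdivrMr ?mulr_gt0//.
  have e : a ^+ 2 = b ^+ 2 * expR (- (2 * (L * l))).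
    by rewrite {1}la exprMn; congr (_ * _); rewrite expr2 -expRD; congr expR; ring.
  have := expR_ge1Dx (- (2 * (L * l))) => h.
  have := ler_wpM2l (exprn_ge0 2 (ltW b0)) h; rewrite -e; lra.
have h2 : l * a <= (b - a) / L.
  rewrite ler_pdivlMr//; have := ler_wpM2l (ltW a0) (expR_ge1Dx (L * l)); rewrite -lb; lra.
have d0 : 0 < q - p by rewrite subr_gt0.
have h3 : (q - p)^-1 * (l * a) ^+ 2 <= (q - p)^-1 * ((b - a) / L) ^+ 2.
  rewrite ler_wpM2l ?invr_ge0 ?(ltW d0)// ler_sqr ?nnegrE ?mulr_ge0 ?(ltW a0)//.
    by rewrite subr_ge0.
  by rewrite invr_ge0 ltW.
have h4 : l * (1 - l / (q - p)) <= (q - p) * ((p < t)%R%:R - (q < t)%R%:R).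
  rewrite /l; case: (ltP q t) => qt.
    have pt : p < t by exact: lt_trans pq qt.
    by rewrite pt (min_l (ltW pt)) divff ?gt_eqF// subrr mulr0 subrr mulr0.
  case: (ltP p t) => pt; last by rewrite subrr mul0r subrr mulr0.
  rewrite subr0 mulr1; apply: (@le_trans _ _ (t - p)); last lra.
  rewrite ler_piMr ?subr_ge0 ?(ltW pt)// gerBl divr_ge0 ?subr_ge0 ?(ltW pt) ?(ltW pq)//.
have h5 : l * b ^+ 2 - (q - p)^-1 * (l * a) ^+ 2 =
    l * (b ^+ 2 - a ^+ 2) + a ^+ 2 * (l * (1 - l / (q - p))) by field; rewrite gt_eqF.
have h6 : l * (b ^+ 2 - a ^+ 2) <= (q - p) * (b ^+ 2 - a ^+ 2).
  by rewrite ler_wpM2r// subr_ge0 ler_sqr ?nnegrE ?(ltW a0) ?(ltW b0).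
have h7 : a ^+ 2 * (l * (1 - l / (q - p))) <= l * (1 - l / (q - p)).
  rewrite ler_piMl ?exprn_ile1 ?(ltW a0)// mulr_ge0// subr_ge0 ler_pdivrMr// mul1r//.
lra.
Qed.

Lemma time_defect_le (T : R) (N : nat) L t : 0 < T -> (0 < N)%N -> 0 < L ->
  heat_int (2 * L) t 0 T - (dt T N)^-1 *
    \sum_(n < N) heat_int L t (n%:R * dt T N) (n.+1%:R * dt T N) ^+ 2 <= 2 * dt T N.
Proof.
move=> T0 N0 L0; have dt0 := dt_gt0 T0 N0.
pose h n := heat_int (2 * L) t (n%:R * dt T N) (n.+1%:R * dt T N) -
  (dt T N)^-1 * heat_int L t (n%:R * dt T N) (n.+1%:R * dt T N) ^+ 2.
have -> : heat_int (2 * L) t 0 T = \sum_(n < N) heat_int (2 * L) t (n%:R * dt T N) (n.+1%:R * dt T N).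
  pose e n := expR (- (2 * L) * (t - Num.min (n%:R * dt T N) t)) / (2 * L).
  rewrite (eq_bigr (fun n : 'I_N => e n.+1 - e n)); last first.
    by move=> n _; rewrite /heat_int mulrBl.
  rewrite -(big_mkord xpredT (fun n => e n.+1 - e n)) telescope_sumr//.
  by rewrite /e mulr_dt// mul0r /heat_int mulrBl.
rewrite mulr_sumr -sumrB.
pose g n := dt T N * (decay L t (n%:R * dt T N) ^+ 2 - (n%:R * dt T N < t)%R%:R).
apply: (@le_trans _ _ (g N - g 0%N)).
  apply: (@ler_sum_telescope R h g) => n.
  have pq : n%:R * dt T N < n.+1%:R * dt T N by rewrite ltr_pM2r// ltr_nat.
  have := @heat_cell_defect L t _ _ L0 pq; rewrite cell_length /h /g; lra.
rewrite /g -mulrBr mulrC ler_wpM2r ?(ltW dt0)//.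
have b01 r : 0 <= decay L t r ^+ 2 <= 1.
  by rewrite exprn_even_ge0//= exprn_ile1 ?expR_ge0// expR_decay_le1// ltW.
have /andP[h1 h2] := b01 (N%:R * dt T N); have /andP[h3 h4] := b01 (0%:R * dt T N).
have c1 : (0%:R * dt T N < t)%R%:R <= 1 :> R by case: (_ < t)%R.
have c2 : 0 <= (N%:R * dt T N < t)%R%:R :> R by [].
lra.
Qed.

End time_averages.

(** * Bound and continuity of the error *)

Section error_bound.
Context {R : realType} {d : nat} (hd : d = 2%N \/ d = 3%N).
Context (T : R) (N J : nat).
Hypotheses (T0 : 0 < T) (N0 : (0 < N)%N) (J0 : (0 < J)%N).
Local Notation lebR := (@lebesgue_measure R).
Local Notation dt := (dt T N).
Local Notation dx := (dx R J).
Local Notation v := (cell_volume (d := d) T N J).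

Let d_gt0 : (0 < d)%N. Proof. by case: hd => ->. Qed.
Let dt0 : 0 < dt. Proof. exact: dt_gt0. Qed.
Let dx0 : 0 < dx. Proof. exact: dx_gt0. Qed.

(** The average over a cell of a product of functions of one variable is the
    product of the averages. *)
Lemma error_termE t (alpha : 'I_d -> nat) : @error_term R d T N J t alpha =
  heat_int (2 * rate alpha) t 0 T -
  (dt^-1 * \sum_(n < N) heat_int (rate alpha) t (n%:R * dt) (n.+1%:R * dt) ^+ 2) *
  \prod_(j < d) grid_energy J (alpha j).
Proof.
rewrite /error_term; congr (_ - _).
pose s j m : R := (\int[lebR]_(y in oo (m%:R * dx) (m.+1%:R * dx)) sineb (alpha j) y) ^+ 2.
have -> : \prod_(j < d) grid_energy J (alpha j) =
    (dx ^+ d)^-1 * \sum_(mu : {ffun 'I_d -> 'I_J}) \prod_j s j (mu j).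
  rewrite -(bigA_distr_bigA (fun j (m : 'I_J) => s j m)) big_split/=.
  by rewrite prodr_const card_ord exprVn.
rewrite /cell_volume invfM mulrACA; congr (_ * _).
rewrite mulr_suml; under [RHS]eq_bigr do rewrite mulr_sumr.
rewrite pair_bigA/=; apply: eq_bigr => i _.
by rewrite /mild_cell_coef exprMn prodrXl.
Qed.

Lemma one_sub_prod_le (I : Type) (r : seq I) (q : I -> R) :
  (forall i, 0 <= q i <= 1) ->
  0 <= \prod_(i <- r) q i <= 1 /\ 1 - \prod_(i <- r) q i <= \sum_(i <- r) (1 - q i).
Proof.
move=> q01; elim: r => [|i r [/andP[h0 h1] h2]].
  by rewrite !big_nil ler01 lexx subrr.
rewrite !big_cons; have /andP[a0 a1] := q01 i.
split; first by rewrite mulr_ge0//= mulr_ile1.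
move: (\prod_(j <- r) q j) (\sum_(j <- r) (1 - q j)) h0 h1 h2 => P S h0 h1 h2.
nra.
Qed.

(** With A, B and q as in the proof, A - B q = (A - B) q + A (1 - q): the first
    summand is the error in time and the second one the error in space. *)
Lemma error_term_le t (alpha : 'I_d -> nat) (i : 'I_d) (p : R) :
  positive_index alpha -> (forall j, alpha j <= alpha i)%N -> 0 <= p <= 2 ->
  @error_term R d T N J t alpha <=
  Num.min (2 * dt) ((2 * (alpha i)%:R ^+ 4)^-1) +
  d%:R * pi ^+ 2 * dx `^ p * (((alpha i)%:R ^+ 4)^-1 * (alpha i)%:R `^ p).
Proof.
move=> a0 imax p02; rewrite error_termE.
set A := heat_int _ _ _ _; set B := dt^-1 * _; set q := \prod_j _.
have L0 : 0 < rate (R := R) alpha by exact: rate_gt0.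
have m0 : 0 < (alpha i)%:R :> R by rewrite ltr0n.
have m4 : 0 < (alpha i)%:R ^+ 4 :> R by rewrite exprn_gt0.
have L20 : 0 < 2 * rate (R := R) alpha by rewrite mulr_gt0.
have Lm : (2 * rate alpha)^-1 <= (2 * (alpha i)%:R ^+ 4)^-1 :> R.
  have h : 2 * (alpha i)%:R ^+ 4 <= 2 * rate alpha :> R by rewrite ler_wpM2l ?rate_ge.
  by rewrite lef_pV2 ?posrE; [exact: h|exact: L20|exact: mulr_gt0].
have g01 j : 0 <= (grid_energy J (alpha j) : R) <= 1.
  by have [] := grid_energy_bounds (R := R) J0 (a0 j).
have [/andP[q0 q1] q2] := one_sub_prod_le (index_enum 'I_d) g01.
have A0 : 0 <= A by apply: heat_int_ge0 => //; exact: ltW.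
have A1 : A <= (2 * (alpha i)%:R ^+ 4)^-1 by exact: le_trans (heat_int_le_inv _ _ _ L20) Lm.
have B0 : 0 <= B.
  by rewrite /B mulr_ge0 ?invr_ge0 ?(ltW dt0)// sumr_ge0// => n _; exact: exprn_even_ge0.
have AB : A - B <= 2 * dt by exact: time_defect_le.
have -> : A - B * q = (A - B) * q + A * (1 - q) by ring.
apply: lerD.
  have X0 : 0 <= Num.min (2 * dt) ((2 * (alpha i)%:R ^+ 4)^-1).
    by rewrite le_min mulr_ge0 ?(ltW dt0)//= invr_ge0 mulr_ge0 // ltW.
  apply: (@le_trans _ _ (Num.min (2 * dt) ((2 * (alpha i)%:R ^+ 4)^-1) * q)).
    by apply: ler_wpM2r => //; rewrite le_min AB/=; lra.
  by rewrite ler_piMr.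
have q3 : 1 - q <= d%:R * (2 * pi ^+ 2 * ((alpha i)%:R * dx) `^ p).
  apply: (le_trans q2).
  apply: (@le_trans _ _ (\sum_(j < d) (2 * pi ^+ 2 * ((alpha i)%:R * dx) `^ p))); last first.
    by rewrite sumr_const card_ord -[leLHS]mulr_natl.
  apply: ler_sum => j _; apply: (le_trans (grid_defect_le J0 (a0 j) p02)).
  rewrite ler_wpM2l ?mulr_ge0 ?exprn_ge0 ?pi_ge0//.
  have [p0 _] := andP p02.
  apply: (ge0_ler_powR p0); rewrite ?nnegrE ?mulr_ge0 ?(ltW dx0)//.
  by rewrite ler_wpM2r ?(ltW dx0)// ler_nat imax.
apply: (@le_trans _ _ ((2 * (alpha i)%:R ^+ 4)^-1 *
    (d%:R * (2 * pi ^+ 2 * ((alpha i)%:R * dx) `^ p)))).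
  by apply: ler_pM => //; rewrite subr_ge0.
rewrite powRM ?(ltW m0) ?(ltW dx0)//.
rewrite le_eqVlt; apply/orP; left; apply/eqP; field.
by rewrite gt_eqF.
Qed.

(** The exponent p = 4 - d - 2 e is chosen so that the space errors of the indices
    with largest entry m add up to a multiple of m^(-1 - 2 e). *)
Lemma boxsum_error_term_le t K (e : R) : 0 < e <= (4 - d%:R) / 2 ->
  boxsum (@error_term R d T N J t) K <=
  d%:R * (8 + 2 * d%:R * pi ^+ 2) *
  (dt `^ ((4 - d%:R) / 4) + e^-1 * dx `^ (4 - d%:R - 2 * e)).
Proof.
move=> /andP[e0 ed].
have dle : (d%:R : R) <= 3 by case: hd => ->; rewrite ler_nat.
have dge : (2 : R) <= d%:R by case: hd => ->; rewrite ler_nat.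
pose p : R := 4 - d%:R - 2 * e.
have p02 : 0 <= p <= 2 by rewrite /p; apply/andP; split; lra.
pose c : R := d%:R * pi ^+ 2 * dx `^ p.
have c0 : 0 <= c by rewrite /c !mulr_ge0 ?exprn_ge0 ?pi_ge0 ?powR_ge0.
pose b := dt `^ 4^-1.
have b0 : 0 < b by exact: powR_gt0.
have b4 : b ^+ 4 = dt.
  by rewrite -powR_mulrn ?(ltW b0)// /b -powRrM mulVf ?powRr1 ?(ltW dt0)// pnatr_eq0.
pose f (m : nat) : R := Num.min (2 * dt) ((2 * m%:R ^+ 4)^-1) +
  c * ((m%:R ^+ 4)^-1 * m%:R `^ p).
apply: (le_trans (@boxsum_max_le R d (@error_term R d T N J t) f K d_gt0 _ _)).
- move=> m; have m4 : 0 <= m%:R ^+ 4 :> R by rewrite exprn_ge0.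
  apply: addr_ge0; last by rewrite mulr_ge0// mulr_ge0 ?invr_ge0 ?powR_ge0.
  by rewrite le_min mulr_ge0 ?(ltW dt0)//= invr_ge0 mulr_ge0.
- by move=> alpha i a0 imax; exact: error_term_le.
rewrite -mulrA ler_wpM2l//.
have -> : \sum_(m < K) m.+1%:R ^+ d.-1 * f m.+1 =
    \sum_(m < K) m.+1%:R ^+ d.-1 * Num.min (2 * b ^+ 4) ((2 * m.+1%:R ^+ 4)^-1) +
    c * \sum_(m < K) m.+1%:R `^ (- (1 + 2 * e)).
  rewrite mulr_sumr -big_split/=; apply: eq_bigr => m _.
  have m0 : 0 < m.+1%:R :> R by [].
  rewrite /f b4 mulrDr; congr (_ + _); rewrite mulrCA; congr (_ * _).
  rewrite -!powR_mulrn ?(ltW m0)// -powRN mulrA -!powRD; last 2 first.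
  - by apply/implyP => _; rewrite gt_eqF.
  - by apply/implyP => _; rewrite gt_eqF.
  congr (_ `^ _); rewrite /p; case: hd => ->; rewrite /=; lra.
have h1 : \sum_(m < K) m.+1%:R ^+ d.-1 * Num.min (2 * b ^+ 4) ((2 * m.+1%:R ^+ 4)^-1)
    <= 8 * dt `^ ((4 - d%:R) / 4).
  apply: (le_trans (sum_min_le hd K b0)); rewrite ler_wpM2l//.
  rewrite -powR_mulrn ?(ltW b0)// /b -powRrM natrB; last by case: hd => ->.
  by rewrite mulrC.
have h2 : \sum_(m < K) m.+1%:R `^ (- (1 + 2 * e)) <= 2 * e^-1.
  apply: (le_trans (sum_powR_le K _)); first by rewrite mulr_gt0.
  rewrite invfM -ler_pdivrMr ?invr_gt0// invrK mulrDl mul1r -mulrA mulVf ?gt_eqF//.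
  by rewrite mulr1; lra.
have h3 : c * (\sum_(m < K) m.+1%:R `^ (- (1 + 2 * e))) <= c * (2 * e^-1) by rewrite ler_wpM2l.
set D1 := dt `^ _ in h1 *; set D2 := dx `^ _.
have D10 : 0 <= D1 by exact: powR_ge0.
have D20 : 0 <= e^-1 * D2 by rewrite mulr_ge0 ?powR_ge0 ?invr_ge0 ?(ltW e0).
have dp : 0 <= d%:R * pi ^+ 2 :> R by rewrite mulr_ge0 ?exprn_ge0 ?pi_ge0.
apply: (le_trans (lerD h1 h3)).
have -> : c * (2 * e^-1) = 2 * (d%:R * pi ^+ 2) * (e^-1 * D2) by rewrite /c /D2 /p; ring.
have -> : (8 + 2 * d%:R * pi ^+ 2) * (D1 + e^-1 * D2) =
  8 * D1 + 2 * (d%:R * pi ^+ 2) * (e^-1 * D2) + (8 * (e^-1 * D2) + 2 * (d%:R * pi ^+ 2) * D1) by ring.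
by rewrite lerDl addr_ge0// mulr_ge0// mulr_ge0.
Qed.

(** For a fixed grid this majorant is summable and independent of [t]; hence the
    series of the errors converges uniformly in time. *)
Lemma norm_error_term_le t (alpha : 'I_d -> nat) : positive_index alpha ->
  `|@error_term R d T N J t alpha| <=
  (1 + v^-1 * (#|{: cell_index (d := d) N J}|%:R * 2 ^+ d)) * (rate alpha)^-1.
Proof.
move=> a0; have r0 := rate_gt0 (R := R) d_gt0 a0.
have r20 : 0 < 2 * rate (R := R) alpha by rewrite mulr_gt0.
have v0 : 0 < v by exact: cell_volume_gt0.
have r1 : 1 <= rate (R := R) alpha.
  apply: le_trans (rate_ge alpha (Ordinal d_gt0)); rewrite exprn_ege1// ler1n.
  exact: a0.
rewrite /error_term [leRHS]mulrDl mul1r; apply: (le_trans (ler_normB _ _)); apply: lerD.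
  rewrite ger0_norm ?heat_int_ge0 ?(ltW T0)//.
  apply: (le_trans (heat_int_le_inv _ _ _ r20)).
  by rewrite lef_pV2 ?posrE// ler_peMl ?(ltW r0)// ler1n.
rewrite normrM ger0_norm ?invr_ge0 ?(ltW v0)// -[leRHS]mulrA ler_wpM2l ?invr_ge0 ?(ltW v0)//.
apply: (le_trans (ler_norm_sum _ _ _)).
apply: (@le_trans _ _ (\sum_(i : cell_index (d := d) N J) (2 ^+ d * (rate alpha)^-1))).
  apply: ler_sum => i _; rewrite normrX.
  have h := mild_cell_coef_le hd T0 N0 J0 t i a0.
  apply: (@le_trans _ _ (((rate alpha)^-1 * Num.sqrt 2 ^+ d) ^+ 2)).
    by rewrite ler_sqr ?nnegrE// (le_trans _ h).
  rewrite exprMn mulrC -exprM mulnC exprM sqr_sqrtr// ler_wpM2l ?exprn_ge0//.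
  by rewrite expr2 ler_piMr ?invr_ge0 ?(ltW r0)// invf_le1.
by rewrite sumr_const -[leLHS]mulr_natl mulrA.
Qed.

Definition limit_error t : R := limn (boxsum (@error_term R d T N J t)).

Lemma continuous_heat_int (L p q : R) : continuous (fun t => heat_int L t p q).
Proof.
have cmin (r : R) : continuous (fun t : R => Num.min r t).
  have -> : (fun t : R => Num.min r t) = (fun t => (r + t - `|r - t|) / 2%:R).
    by apply/funext => t; exact: minr_absE.
  move=> t; apply: cvgM; last exact: cvg_cst.
  apply: cvgB; first by apply: cvgD; [exact: cvg_cst|exact: cvg_id].
  by apply: cvg_norm; apply: cvgB; [exact: cvg_cst|exact: cvg_id].
have h (r : R) : continuous (fun t : R => expR (- L * (t - Num.min r t))).
  move=> t; apply: continuous_comp; last exact: continuous_expR.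
  apply: cvgM; first exact: cvg_cst.
  apply: cvgB; first exact: cvg_id.
  exact: cmin.
by move=> t; apply: cvgM; [apply: cvgB; exact: h|exact: cvg_cst].
Qed.

Lemma continuous_error_term (alpha : 'I_d -> nat) :
  continuous (fun t => @error_term R d T N J t alpha).
Proof.
move=> t; apply: cvgB; first exact: continuous_heat_int.
apply: cvgM; first exact: cvg_cst.
apply: cvg_big => [|i _]; first exact: add_continuous.
have h : mild_cell_coef T s i alpha @[s --> t] --> mild_cell_coef T t i alpha.
  by apply: cvgM; [exact: continuous_heat_int|exact: cvg_cst].
exact: (cvgM h h).
Qed.

Lemma continuous_limit_error : continuous limit_error.
Proof.
pose c := 1 + v^-1 * (#|{: cell_index (d := d) N J}|%:R * 2 ^+ d).
pose G alpha := c * (rate (R := R) (d := d) alpha)^-1.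
have v0 : 0 < v by exact: cell_volume_gt0.
have c0 : 0 <= c by rewrite addr_ge0 ?mulr_ge0 ?invr_ge0 ?exprn_ge0 ?(ltW v0).
have GZ K : boxsum G K <= c * (2 * d%:R).
  by rewrite boxsumZ ler_wpM2l// boxsum_inv_rate_le.
have FG t alpha : positive_index alpha -> `|@error_term R d T N J t alpha| <= G alpha.
  exact: norm_error_term_le.
have cG : cvgn (boxsum G).
  apply: (is_cvg_boxsum_ge0 _ GZ) => alpha a0.
  exact: le_trans (normr_ge0 _) (FG 0 alpha a0).
move=> t; apply/cvgrPdist_le => e e0.
have [K hK] : exists K, limn (boxsum G) - boxsum G K <= e / 3.
  have /cvgrPdist_le/(_ (e / 3)) h := cG.
  have [|K _ /(_ K (leqnn K)) hK] := h; first by rewrite divr_gt0.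
  by exists K; exact: le_trans (ler_norm _) hK.
have cK : continuous (fun t => boxsum (@error_term R d T N J t) K).
  move=> s; apply: cvg_big => [|a _]; first exact: add_continuous.
  exact: continuous_error_term.
have /cvgrPdist_le/(_ (e / 3)) := cK t.
move=> /(_ _)/wrap[]; first by rewrite divr_gt0.
apply: filterS => s hs.
have h1 := lim_boxsum_tail K (FG t) GZ; have h2 := lim_boxsum_tail K (FG s) GZ.
have -> : limit_error t - limit_error s =
  (limit_error t - boxsum (@error_term R d T N J t) K) +
  (boxsum (@error_term R d T N J t) K - boxsum (@error_term R d T N J s) K) -
  (limit_error s - boxsum (@error_term R d T N J s) K) by ring.
rewrite (le_trans (ler_normB _ _))//.
have := ler_normD (limit_error t - boxsum (@error_term R d T N J t) K)
  (boxsum (@error_term R d T N J t) K - boxsum (@error_term R d T N J s) K).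
move: h1 h2 hs; rewrite -!/(limit_error _); lra.
Qed.

Lemma limit_errorE t : 0 <= t <= T ->
  \int[leb R d]_(x in cube) projection_error T N J t x = limit_error t.
Proof.
move=> tT; have [_ h] := Rintegral_projection_error hd T0 N0 J0 tT.
by apply/esym/cvg_lim.
Qed.

Lemma limit_error_ge0 t : 0 <= t <= T -> 0 <= limit_error t.
Proof.
move=> tT; rewrite -limit_errorE//; apply: Rintegral_ge0 => x _.
rewrite -(integral_sqr_sub_averages hd T0 N0 J0).
by apply: Rintegral_ge0 => z _; rewrite exprn_even_ge0.
Qed.

Lemma limit_error_le t (e : R) : 0 < e <= (4 - d%:R) / 2 -> 0 <= t <= T ->
  limit_error t <= d%:R * (8 + 2 * d%:R * pi ^+ 2) *
  (dt `^ ((4 - d%:R) / 4) + e^-1 * dx `^ (4 - d%:R - 2 * e)).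
Proof.
move=> he tT; have [_ h] := Rintegral_projection_error hd T0 N0 J0 tT.
apply: limr_le; first by apply/cvg_ex; eexists; exact: h.
by apply: nearW => K; exact: boxsum_error_term_le.
Qed.

End error_bound.

Theorem theorem3p1 (R : realType) (d : nat) (hd : d = 2%N \/ d = 3%N) :
  exists C : R, 0 < C /\
  forall (T : R) (N J : nat) (disp : measure_display)
    (Omega : measurableType disp) (P : probability Omega R)
    (W : (measurableTypeR R * Rn R d -> R) -> Omega -> R)
    (u : R -> Rn R d -> Omega -> R),
  0 < T -> (0 < N)%N -> (0 < J)%N ->
  measure_is_complete P ->
  white_noise P T W ->
  mild_solution P T W u ->
  let err := mean_square_error P u (reg_solution T N J W) in
  exists2 tmax : R, 0 <= tmax <= T &
    (forall t : R, 0 <= t <= T -> (err t <= err tmax)%E) /\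
    (forall eps : R, 0 < eps <= (4 - d%:R) / 2 ->
      (err tmax <=
        (C * (pd d (dt T N `^ (1 / 4)) `^ (1 / 2)
                * dt T N `^ ((4 - d%:R) / 8)
              + eps `^ (- (1 / 2)) * dx R J `^ ((4 - d%:R) / 2 - eps)))%:E)%E).
Proof.
pose m2 : R := fine (@gaussian_moment2 R).
have m20 : 0 <= m2 by rewrite fine_ge0// gaussian_moment2_ge0.
pose c0 := m2 * (d%:R * (8 + 2 * d%:R * pi ^+ 2)).
have c00 : 0 <= c0.
  by rewrite !mulr_ge0// addr_ge0// !mulr_ge0 ?exprn_ge0 ?pi_ge0.
exists (1 + c0); split; first by rewrite ltr_pwDl.
move=> T N J disp Omega P W u T0 N0 J0 _ wn mu err.
have dt0 : 0 < dt T N by exact: dt_gt0.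
have dx0 : 0 < dx R J by exact: dx_gt0.
have errE t : 0 <= t <= T ->
    err t = (Num.sqrt (m2 * limit_error (d := d) T N J t))%:E.
  move=> tT; have [ip _] := Rintegral_projection_error hd T0 N0 J0 tT.
  rewrite /err (mean_square_errorE hd T0 N0 J0 wn mu tT).
  have mc := @measurable_cube R d.
  rewrite (EFin_Rintegral mc (integrableZ_EFin mc _ ip)) RintegralZl//.
  rewrite (limit_errorE hd)// poweR_EFin powR12_sqrt//.
  by rewrite mulr_ge0// (limit_error_ge0 hd).
have [tmax] := EVT_max (ltW T0)
  (continuous_subspaceT (continuous_limit_error hd T0 N0 J0)).
rewrite in_itv/= => tmaxT tmax_max.
clearbody err; exists tmax; [exact: tmaxT|split].
  move=> t tT; rewrite !errE// lee_fin ler_wsqrtr// ler_wpM2l//.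
  by apply: tmax_max; rewrite in_itv.
move=> eps eps0; rewrite errE// lee_fin.
set x1 := _ * dt T N `^ _; set x2 := _ * dx R J `^ _.
have /andP[e0 _] := eps0.
have x10 : 0 <= x1 by rewrite mulr_ge0 ?powR_ge0.
have x20 : 0 <= x2 by rewrite mulr_ge0 ?powR_ge0.
have x1E : dt T N `^ ((4 - d%:R) / 4) <= x1 ^+ 2.
  have pd1 : 1 <= pd d (dt T N `^ (1 / 4)).
    by rewrite /pd lerDl sumr_ge0// => i _; rewrite exprn_ge0// powR_ge0.
  rewrite /x1 exprMn -[leLHS]mul1r ler_pM// ?powR_ge0//.
    by rewrite (div1r 2) powR12_sqrt ?sqr_sqrtr// (le_trans _ pd1).
  rewrite -powR_mulrn ?powR_ge0// -powRrM.
  suff -> : (4 - d%:R) / 8 * 2%:R = (4 - d%:R) / 4 :> R by [].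
  by field.
have x2E : eps^-1 * dx R J `^ (4 - d%:R - 2 * eps) = x2 ^+ 2.
  rewrite /x2 exprMn powRN exprVn div1r powR12_sqrt ?(ltW e0)// sqr_sqrtr ?(ltW e0)//.
  rewrite -powR_mulrn ?powR_ge0// -powRrM; congr (_ * _ `^ _).
  by field.
have le1 := limit_error_le hd T0 N0 J0 eps0 tmaxT.
have C0 : 0 <= (1 + c0) * (x1 + x2) by rewrite mulr_ge0 ?addr_ge0.
rewrite -[leRHS]ger0_norm// -sqrtr_sqr ler_wsqrtr// exprMn.
apply: (@le_trans _ _ (c0 * (x1 ^+ 2 + x2 ^+ 2))).
  rewrite /c0 -mulrA ler_wpM2l//; apply: (le_trans le1).
  rewrite ler_wpM2l ?x2E ?lerD2r// mulr_ge0// addr_ge0// !mulr_ge0 ?exprn_ge0 ?pi_ge0//.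
apply: ler_pM => //.
- by rewrite addr_ge0// exprn_ge0.
- by have := sqr_ge0 c0; lra.
- by have := mulr_ge0 x10 x20; lra.
Qed.
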